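(* Let $G$ be a torsion-free, $2$-generated group. If $G$ is not a free group, then $G$ is one-ended.
   Context: A group is $2$-generated if it has a generating set with two elements. The trivial group is regarded as free (of rank zero). *)

(* Defs.v *)
From mathcomp Require Import all_boot finmap.
From mathcomp Require Import boolp classical_sets.

Set Implicit Arguments.
Unset Strict Implicit.
Unset Printing Implicit Defensive.

Local Open Scope fset_scope.
Local Open Scope classical_set_scope.
Local Open Scope group_scope.

Definition torsion_free (G : groupType) : Prop :=
  forall (x : G) (n : nat), (0 < n)%N -> x ^+ n = 1 -> x = 1.

Definition subgroup (G : groupType) (H : set G) : Prop :=
  group_closed [in H].

Definition generates (G : groupType) (S : set G) : Prop :=
  smallest (@subgroup G) S = setT.

(* The two generators may coincide; this only adds the trivial group, because
   a nontrivial group generated by x is also generated by the pair {1, x}. *)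
Definition two_generated (G : groupType) : Prop :=
  exists a b : G, generates [set a; b].

(* Universal property: every map from X to a group extends uniquely to a
   homomorphism on G.  The map is given as the restriction to X of a function
   defined on all of G, which is no loss of generality as groups are inhabited. *)
Definition is_basis (G : groupType) (X : set G) : Prop :=
  forall (H : groupType) (f : G -> H),
    exists! phi : G -> H,
      monoid_morphism phi /\ (forall x, X x -> phi x = f x).

(* The basis is arbitrary; it is empty exactly when G is trivial. *)
Definition free_group (G : groupType) : Prop := exists X : set G, is_basis X.

(* x and y are joined by an edge path all of whose vertices avoid K. *)
Definition joined_outside (V : choiceType) (e : rel V) (K : {fset V})
    (x y : V) : Prop :=
  exists p : seq V,
    [/\ path e x p, last x p = y & all (fun v => v \notin K) (x :: p)].

Definition component_outside (V : choiceType) (e : rel V) (K : {fset V})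
    (C : set V) : Prop :=
  exists2 x : V, x \notin K & C = [set y | joined_outside e K x y].

(* Freudenthal ends of a locally finite graph with symmetric adjacency e:
   elements of the inverse limit, over the finite vertex sets K, of the sets of
   connected components of the complement of K.  Components are nonempty, so by
   compatibility the component selected by an end is never finite. *)
Definition is_end (V : choiceType) (e : rel V) (eps : {fset V} -> set V) : Prop :=
  (forall K, component_outside e K (eps K)) /\
  (forall K L : {fset V}, (K `<=` L)%fset -> eps L `<=` eps K).

Definition one_ended_graph (V : choiceType) (e : rel V) : Prop :=
  exists! eps : {fset V} -> set V, is_end e eps.

Definition cayley (G : groupType) (S : {fset G}) : rel G :=
  [rel x y | (x^-1 * y \in S) || (y^-1 * x \in S)].

(* The number of ends of a finitely generated group is that of its Cayley graph
   with respect to any finite generating set. *)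
Definition one_ended (G : groupType) : Prop :=
  (exists S : {fset G}, generates [set` S]) /\
  (forall S : {fset G}, generates [set` S] -> one_ended_graph (cayley S)).

(* Main.v *)
Require Import Defs.
From mathcomp Require Import all_boot finmap.
From mathcomp Require Import boolp classical_sets functions cardinality filter.
From mathcomp Require Import zify.

(** An infinite finitely generated group is one-ended unless it carries a cut:
    an infinite set [A] with infinite complement such that, for every [u], only
    finitely many [x] have exactly one of [x] and [x * u] in [A]. So it must be
    shown that a torsion-free group [G] generated by two elements and carrying
    a cut is free. In general this is Stallings' theorem on ends followed by
    Grushko's theorem on the ranks of free products; for two generators and no
    torsion both can be carried out by hand, on one and the same tree.

    The tree comes from a cut that is nested with all its left translates,
    which is found by Dunwoody's method ([nested_narrow]). Fix a generating
    pair and call a cut narrow if it minimises a weighted count of the walls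
    crossed by the generators. By compactness of the space of subsets, only
    finitely many narrow cuts cross a given one. Opposite infinite corners of
    two crossing narrow cuts are narrow, by submodularity, and fewer narrow
    cuts cross them in total. Hence a narrow cut crossed as rarely as possible
    crosses none of its translates.

    The translates [x^-1 A] of a nested cut are the edges of a tree on which
    [G] acts with trivial edge stabilisers. The tree itself is never built: the
    set [walls A u] indexes the edges on the geodesic from a base vertex to its
    image under [u], and [codir A u v] says that the geodesics to the images
    under [u] and [v] leave the base vertex along the same edge.

    Nielsen reduction then replaces Grushko's theorem. Among all cuts and all
    generating pairs, choose [A], [a], [b] with [norm A b] as small as possible
    and then [norm A a] as small as possible ([lex_minimal]). In each case a
    generating pair plays ping-pong on [G]. If [b] fixes the base vertex, its
    powers permute the directions there without fixed points
    ([pingpong_elliptic]). If neither direction of [a] is one of [b], the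
    powers of [a] and [b] never cancel against each other
    ([pingpong_transverse]). If [a] and [b], up to inversion, start in the same
    direction, minimality bounds the cancellation, so that some wall of each
    generator survives it ([pingpong_overlap]). By ping-pong no nonempty
    reduced word is trivial, which makes the pair a basis ([free_of_pingpong]).
    What remains is the case that one generator is trivial, where [G] is
    infinite cyclic or trivial. *)

Set Implicit Arguments.
Unset Strict Implicit.
Unset Printing Implicit Defensive.

Local Open Scope classical_set_scope.
Local Open Scope group_scope.

(** * Counting in finite classical sets *)

Definition ncard (T : choiceType) (X : set T) : nat := #|` fset_set X|.

Lemma ncard_sub (T : choiceType) (X Y : set T) :
  finite_set Y -> X `<=` Y -> (ncard X <= ncard Y)%N.
Proof.
move=> finY XY; have finX := sub_finite_set XY finY.
by apply: fsubset_leq_card; rewrite -fset_set_sub.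
Qed.

Lemma ncard_lt (T : choiceType) (X Y : set T) (y : T) :
  finite_set Y -> X `<=` Y -> Y y -> ~ X y -> (ncard X < ncard Y)%N.
Proof.
move=> finY XY Yy nXy; have finX := sub_finite_set XY finY.
have fyX : finite_set (y |` X) by rewrite finite_setU; split.
apply: leq_trans (ncard_sub finY (X := y |` X) _).
  have nyX : y \notin fset_set X by rewrite in_fset_set//; apply/negP;
    rewrite inE.
  by rewrite /ncard fset_setU1// cardfsU1 nyX.
by move=> z [->|/XY].
Qed.

Lemma ncardUI (T : choiceType) (X Y : set T) :
  finite_set X -> finite_set Y ->
  (ncard (X `|` Y) + ncard (X `&` Y) = ncard X + ncard Y)%N.
Proof.
by move=> fX fY; rewrite /ncard fset_setU// fset_setI// cardfsUI.
Qed.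

Lemma ncard_eq0 (T : choiceType) (X : set T) :
  finite_set X -> ncard X = 0%N -> X = set0.
Proof. by move=> fX /eqP; rewrite cardfs_eq0 => /eqP /fset_set_set0 ->. Qed.

Lemma ncard_image_le (T U : choiceType) (f : T -> U) (X : set T) :
  finite_set X -> (ncard (f @` X) <= ncard X)%N.
Proof.
by move=> fX; rewrite /ncard fset_set_image//; apply: leq_imfset_card.
Qed.

Lemma ncard_image (T U : choiceType) (f : T -> U) (X : set T) :
  finite_set X -> injective f -> ncard (f @` X) = ncard X.
Proof. by move=> fX inj_f; rewrite /ncard fset_set_image//; apply:
  card_imfset. Qed.

(** The sizes of two sets add up to those of their union and intersection. The
    submodularity of wall counts is an instance, and so, in the strict form
    below, is the decrease of crossing numbers under uncrossing. *)
Lemma ncard_exchange (T : choiceType) (X Y Z W : set T) :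
  finite_set Z -> finite_set W ->
  X `|` Y `<=` Z `|` W -> X `&` Y `<=` Z `&` W ->
  (ncard X + ncard Y <= ncard Z + ncard W)%N.
Proof.
move=> fZ fW sU sI.
have fU : finite_set (Z `|` W) by rewrite finite_setU.
have fI : finite_set (Z `&` W) by apply: (finite_setIl W fZ).
have fX : finite_set X by apply: sub_finite_set fU => x Xx; apply: sU; left.
have fY : finite_set Y by apply: sub_finite_set fU => x Yx; apply: sU; right.
rewrite -(ncardUI fX fY) -(ncardUI fZ fW).
by apply: leq_add; apply: ncard_sub.
Qed.

Lemma ncard_exchange_lt (T : choiceType) (X Y Z W : set T) (z : T) :
  finite_set Z -> finite_set W ->
  X `|` Y `<=` Z `|` W -> X `&` Y `<=` Z `&` W ->
  Z z -> ~ X z -> ~ Y z ->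
  (ncard X + ncard Y < ncard Z + ncard W)%N.
Proof.
move=> fZ fW sU sI Zz nX nY.
have fU : finite_set (Z `|` W) by rewrite finite_setU.
have fI : finite_set (Z `&` W) by apply: (finite_setIl W fZ).
have fX : finite_set X by apply: sub_finite_set fU => x Xx; apply: sU; left.
have fY : finite_set Y by apply: sub_finite_set fU => x Yx; apply: sU; right.
rewrite -(ncardUI fX fY) -(ncardUI fZ fW) -addSn.
apply: leq_add; last exact: ncard_sub.
by apply: (@ncard_lt _ _ _ z) => //; [left | case].
Qed.

(** * Generating sets and powers *)

Section Groups.
Variable G : groupType.
Implicit Types (u v x : G) (A B : G -> bool).

Lemma generates_ind (S : set G) (P : G -> Prop) : generates S ->
  P 1 -> (forall u v, P u -> P v -> P (u * v)) -> (forall u, P u -> P u^-1) ->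
  (forall s, S s -> P s) -> forall g, P g.
Proof.
move=> genS P1 PM PV PS g.
have : smallest (@subgroup G) S g by rewrite genS.
apply: (@smallest_sub _ (@subgroup G) S [set x | P x]); last exact: PS.
split; first by rewrite inE.
by move=> x y; rewrite !inE /= => Px Py; apply/PM/PV.
Qed.

(** The powers of [c] are pairwise distinct. This is how torsion-freeness makes
    the stabilisers of walls and of directions trivial. *)
Lemma pow_escape (c : G) (F : set G) : torsion_free G -> c <> 1 ->
  finite_set F -> ~ (forall k : nat, F (c ^+ k)).
Proof.
move=> tfG c1 finF FP.
have /infinite_nat [] : finite_set [set: nat].
have inj : injective (fun k : nat => c ^+ k).
  have H (i j : nat) : (i < j)%N -> c ^+ i = c ^+ j -> False.
    move=> ij e; apply: c1; apply: (tfG _ (j - i)%N); first by rewrite subn_gt0.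
    by rewrite expgnFr ?(ltnW ij)// -e mulgV.
  move=> i j /= e; case: (ltngtP i j) => // ij; first by case: (H _ _ ij e).
  by case: (H _ _ ij (esym e)).
rewrite (_ : [set: nat] = (fun k : nat => c ^+ k) @^-1` F); last first.
  by apply/seteqP; split=> // k _; exact: FP.
by apply: finite_preimage finF; exact: in2W.
Qed.
End Groups.

Lemma generates_pair (G : groupType) (a b a' b' : G) : generates [set a; b] ->
  (forall H : set G, (forall x y, H x -> H y -> H (x * y)) ->
     (forall x, H x -> H x^-1) -> H a' -> H b' -> H a /\ H b) ->
  generates [set a'; b'].
Proof.
move=> gen sub; apply/seteqP; split=> // g _ H [] subH abH.
have HM x y : H x -> H y -> H (x * y).
  by have := group_closedM subH (x := x) (y := y); rewrite !inE.
have HV x : H x -> H x^-1.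
  by have := group_closedV subH (x := x); rewrite !inE.
have [Ha Hb] :=
  sub H HM HV (abH a' (or_introl erefl)) (abH b' (or_intror erefl)).
apply: (generates_ind (P := H) gen _ HM HV).
  by have [] := subH; rewrite inE.
by move=> _ [->|->].
Qed.

(** * Walls and directions *)

(** The translate [x^-1 A] contains exactly one of [1] and [u]; in the tree of
    a nested [A], the edge [x] lies on the geodesic from [1] to [u]. *)
Definition parts (G : groupType) (A : G -> bool) (u x : G) : bool :=
  A x (+) A (x * u).
Definition walls (G : groupType) (A : G -> bool) (u : G) : set G :=
  [set x | parts A u x].

Definition translate (G : groupType) (h : G) (A : G -> bool) : G -> bool :=
  fun x => A (h^-1 * x).

Definition cross (T : Type) (A B : T -> bool) : Prop :=
  [/\ exists x, A x && B x, exists x, A x && ~~ B x,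
      exists x, ~~ A x && B x & exists x, ~~ A x && ~~ B x].

Definition nested (G : groupType) (A : G -> bool) : Prop :=
  forall h, ~ cross A (translate h A).

Section Directions.
Variables (G : groupType) (A : G -> bool).
Implicit Types (u v x : G).

Lemma partsV u x : parts A u^-1 (x * u) = parts A u x.
Proof. by rewrite /parts mulgK addbC. Qed.

Lemma partsVr u x : parts A u^-1 x = parts A u (x * u^-1).
Proof. by rewrite -(partsV u) mulgVK. Qed.

Lemma partsM u v x : parts A (u * v) x = parts A u x (+) parts A v (x * u).
Proof. by rewrite /parts mulgA; do 3!case: (A _). Qed.

Lemma parts1 x : parts A 1 x = false.
Proof. by rewrite /parts mulg1 addbb. Qed.

(** For a nested [A] the walls shared by [u] and [v] form a common initial
    segment of two geodesics from [1], so the relation says that these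
    geodesics start with the same edge. In particular [codir A u u] means that
    [u] moves the base vertex. *)
Definition codir u v := exists x, parts A u x && parts A v x.

Lemma codir_sym u v : codir u v -> codir v u.
Proof. by case=> x; rewrite andbC; exists x. Qed.

Hypothesis nestA : nested A.

(** The point [pij] lies on side [i] of the wall [x] and on side [j] of the
    wall [y], so that these two translates of [A] cross. All properties of
    trees that are needed are obtained by exhibiting such a configuration. *)
Lemma no_four_corners (x y p00 p01 p10 p11 : G) (s t : bool) :
  A (x * p00) = s -> A (y * p00) = t ->
  A (x * p01) = s -> A (y * p01) = ~~ t ->
  A (x * p10) = ~~ s -> A (y * p10) = t ->
  A (x * p11) = ~~ s -> A (y * p11) = ~~ t -> False.
Proof.
move=> x00 y00 x01 y01 x10 y10 x11 y11.
have E p : translate (x * y^-1) A (x * p) = A (y * p).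
  by rewrite /translate invgM invgK mulgA mulgVK.
apply: (nestA (h := x * y^-1)).
have W b c p : A (x * p) = b -> A (y * p) = c ->
  exists z, (A z == b) && (translate (x * y^-1) A z == c).
  by move=> xb yc; exists (x * p); rewrite E xb yc !eqxx.
have {}W b c : exists z, (A z == b) && (translate (x * y^-1) A z == c).
  move: b c (W s t p00) (W s (~~ t) p01) (W (~~ s) t p10) (W (~~ s) (~~ t) p11).
  by move: s t x00 y00 x01 y01 x10 y10 x11 y11 {E W} => [] [] ? ? ? ? ? ? ? ?
    [] [] /= ? ? ? ?; auto.
split.
- by have [z] := W true true; rewrite !eqb_id; exists z.
- by have [z] := W true false; rewrite eqb_id eqbF_neg; exists z.
- by have [z] := W false true; rewrite eqb_id eqbF_neg; exists z.
- by have [z] := W false false; rewrite !eqbF_neg; exists z.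
Qed.

Lemma nestedP (x y : G) (s t : bool) (X := fun g => A (x * g) (+) s)
    (Y := fun g => A (y * g) (+) t) :
  [\/ forall g, ~~ (X g && Y g), forall g, X g -> Y g,
      forall g, Y g -> X g | forall g, X g || Y g].
Proof.
have [H|/forallNP H] := pselect (exists g, X g && Y g); last first.
  by constructor 1 => g; apply/negP/H.
have [H1|/forallNP H1] := pselect (exists g, X g && ~~ Y g); last first.
  by constructor 2 => g Xg; apply: contra_notT (H1 g) => ->; rewrite Xg.
have [H2|/forallNP H2] := pselect (exists g, ~~ X g && Y g); last first.
  by constructor 3 => g Yg; apply: contra_notT (H2 g) => ->; rewrite Yg.
have [H3|/forallNP H3] := pselect (exists g, ~~ X g && ~~ Y g); last first.
  by constructor 4 => g; apply: contra_notT (H3 g); rewrite negb_or.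
case: H H1 H2 H3 => [p11] /andP[X11 Y11] [p10] /andP[X10 Y10]
  [p01] /andP[X01 Y01] [p00] /andP[X00 Y00].
have posE b c : b (+) c -> b = ~~ c by case: b c => [] [].
have negE b c : ~~ (b (+) c) -> b = c by case: b c => [] [].
by case: (@no_four_corners x y p00 p01 p10 p11 s t);
  do [exact: negE | exact: posE].
Qed.

(** Initial segments of the geodesic to [v] are comparable: if [x] did not
    separate [1] from [w], nor [y] separate it from [u], then [1], [u], [v] and
    [w] would occupy the four corners of the walls [x] and [y]. *)
Lemma codir_common v u w x y : parts A u x -> parts A v x -> parts A v y ->
  parts A w y ->
  exists z, [/\ parts A u z, parts A v z & parts A w z].
Proof.
move=> xu xv yv yw.
have [xw|nxw] := boolP (parts A w x); first by exists x.
have [yu|nyu] := boolP (parts A u y); first by exists y.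
exfalso; apply: (@no_four_corners x y 1 w u v (A x) (A y)); rewrite ?mulg1 //;
  move: xu xv yv yw nxw nyu; rewrite /parts; do 2!case: (A (_ * v)); do 2!case:
    (A (_ * u));
  do 2!case: (A (_ * w)); case: (A x); case: (A y) => //.
Qed.

Lemma codir_trans v u w : codir u v -> codir v w -> codir u w.
Proof.
case=> x /andP[xu xv] [y /andP[yv yw]].
by have [z [zu _ zw]] := codir_common xu xv yv yw; exists z; rewrite zu.
Qed.

Lemma codirV u : codir u u -> codir u^-1 u^-1.
Proof. by case=> x; rewrite andbb => xu; exists (x * u); rewrite partsV xu. Qed.

Hypothesis tfG : torsion_free G.
Hypothesis finA : forall u, finite_set (walls A u).

(** Otherwise the sets [c^k Y] increase with [k], while each of them remains
    disjoint from its image under [a]. Then [p] and [a * p] are separated by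
    the boundaries of all the [c^k Y], which are infinitely many walls. *)
Lemma no_expansion (Y : G -> bool) (x a c p : G) (s : bool) :
  (forall g, Y g = A (x * g) (+) s) ->
  (forall g, ~~ (Y g && Y (a^-1 * g))) -> commute a c ->
  (forall g, Y g -> Y (c^-1 * g)) -> Y p -> c = 1.
Proof.
move=> YE disj ac sub Yp; apply: contrapT => c1.
have c1' : c^-1 <> 1 by move=> /eqP; rewrite invg_eq1 => /eqP.
pose F := (fun z => x^-1 * z * p^-1) @` walls A (p^-1 * a * p).
apply: (@pow_escape G c^-1 F tfG c1'); first exact: finite_image.
move=> k; exists (x * c^-1 ^+ k * p); last by rewrite !mulgA mulVg mul1g mulgK.
have Yk : Y (c^-1 ^+ k * p).
  by elim: k => [|k IH]; rewrite ?mul1g// expgS -mulgA; exact: sub.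
have := disj (a * (c^-1 ^+ k * p)); rewrite mulKg Yk andbT.
move: Yk; rewrite !YE /walls /= /parts.
have -> : x * c^-1 ^+ k * p * (p^-1 * a * p) = x * (a * (c^-1 ^+ k * p)).
  have /commuteX-/(_ k) cc : commute a c^-1 by exact: commuteV.
  by rewrite !mulgA mulgK -[x * _ * a]mulgA -cc !mulgA.
rewrite !mulgA; move: (A _) (A _); case: s {YE} => [] [] [] //.
Qed.

(** Nestedness leaves four positions for [Y] and [c Y]. The two inclusions are
    excluded by [no_expansion]. If the two sets cover [G], then [a Y], being
    disjoint from [Y], lies in [c Y], so that [Y] lies in [(a^-1 c) Y]; hence
    [c = a] and disjointness is the hypothesis. *)
Lemma disjoint_powers (Y : G -> bool) (x a c p : G) (s : bool) :
  (forall g, Y g = A (x * g) (+) s) ->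
  (forall g, ~~ (Y g && Y (a^-1 * g))) -> commute a c -> c <> 1 -> Y p ->
  forall g, ~~ (Y g && Y (c^-1 * g)).
Proof.
move=> YE disj ac c1 Yp.
have acV : commute a c^-1 by exact: commuteV.
have YcE g : Y (c^-1 * g) = A (x * c^-1 * g) (+) s by rewrite YE mulgA.
case: (nestedP x (x * c^-1) s s) => H g.
- by rewrite YE YcE H.
- case: c1; apply: (no_expansion YE disj ac _ Yp) => h.
  by rewrite YcE YE; exact: H.
- case: c1; rewrite -[c]invgK -[RHS]invg1; congr (_^-1).
  apply: (no_expansion YE disj acV _ Yp) => h Yh.
  by rewrite invgK YE; apply: H; rewrite -YcE mulKg.
- have ca : a^-1 * c = 1.
    apply: (no_expansion YE disj _ _ Yp).
      by apply: commuteM => //; apply: commuteV.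
    move=> h Yh; have := disj (a * h); rewrite mulKg Yh andbT.
    have := H (a * h); rewrite -YE -YcE => /orP[->//|].
    by rewrite invgM invgK -mulgA.
  have -> : c = a by rewrite -[a]mulg1 -ca mulVKg.
  exact: disj.
Qed.

(** If [u] and [u^-1] start in different directions, the base vertex is on the
    axis of [u], and the half-space behind a wall of [u] is mapped into itself
    by [u]. If they start in the same direction, the half-space containing [1]
    at a common wall is disjoint from its image under [u], hence from its
    images under all nontrivial powers, which thus lie behind that wall. *)
Lemma power_codir u m : codir u u -> codir u (u ^+ m.+1).
Proof.
case=> x0; rewrite andbb => x0u.
have u1 : u <> 1 by move=> u1; move: x0u; rewrite u1 parts1.
have um1 n : u ^+ n.+1 <> 1 by move=> /tfG-/(_ isT).
have [[x /andP[xu xV]]|nrel] := pselect (codir u u^-1).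
  exists x; rewrite xu /=.
  pose X g := A (x * g) (+) A x.
  have X1 : X 1 = false by rewrite /X mulg1 addbb.
  have Xu : X u by rewrite /X addbC.
  have XV : X u^-1 by rewrite /X addbC.
  have XuE g : X (u^-1 * g) = A (x * u^-1 * g) (+) A x by rewrite /X mulgA.
  case: (nestedP x (x * u^-1) (A x) (A x)) => H.
  (* With X and u X disjoint, so would be X and u^2 X, which both contain u. *)
  - have disj g : ~~ (X g && X (u^-1 * g)) by rewrite XuE; exact: H.
    have := disjoint_powers (Y := X) (fun=>
      erefl) disj (commuteX 2 (commute_refl u)) (um1 1%N) Xu u.
    by rewrite Xu expg2 invgM -mulgA mulVg mulg1 XV.
  - by have := H u Xu; rewrite -XuE mulVg X1.
  - by have := H 1; rewrite -XuE mulg1 XV => /(_ isT); rewrite mulg1 addbb.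
  - pose Y g := A (x * g) (+) ~~ A x.
    have YX g : Y g = ~~ X g by rewrite /Y /X addbN.
    have disj g : ~~ (Y g && Y (u^-1 * g)).
      by rewrite !YX -negb_or negbK XuE; exact: H.
    have Y1 : Y 1 by rewrite YX X1.
    have := disjoint_powers (Y := Y) (fun=>
      erefl) disj (commuteX m.+1 (commute_refl u)) (um1 m) Y1 (u ^+ m.+1).
    by rewrite mulVg Y1 andbT YX negbK /X addbC.
have nV : ~~ parts A u^-1 x0.
  by apply: contra_notN nrel => xV; exists x0; rewrite x0u.
have nu : ~~ parts A u (x0 * u).
  by apply: contra_notN nrel => xu; exists (x0 * u); rewrite xu partsV x0u.
exists x0; rewrite x0u /=.
pose X g := A (x0 * g) (+) A x0.
have X1 : X 1 = false by rewrite /X mulg1 addbb.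
have Xu : X u by rewrite /X addbC.
have XV : X u^-1 = false by rewrite /X addbC; exact: negbTE.
have Xuu : X (u * u) by move: nu Xu; rewrite /parts /X mulgA; do 3!case: (A _).
have XuE g : X (u^-1 * g) = A (x0 * u^-1 * g) (+) A x0 by rewrite /X mulgA.
have sub g : X (u^-1 * g) -> X g.
  case: (nestedP x0 (x0 * u^-1) (A x0) (A x0)) => H.
  - by have := H (u * u); rewrite -XuE mulKg -/(X _) Xuu Xu.
  - by have := H u Xu; rewrite -XuE mulVg X1.
  - by rewrite XuE; exact: H.
  - by have := H 1; rewrite -XuE !mulg1 XV addbb.
have -> : parts A (u ^+ m.+1) x0 = X (u ^+ m.+1) by rewrite /X addbC.
by elim: m => // m IH; apply: sub; rewrite expgS mulKg.
Qed.

End Directions.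

(** * Ping-pong from directions at the base vertex *)

(** [U] and its complement are the two tables: nonzero powers of [a] map the
    complement into [U], those of [b] map [U] into the complement. *)
Definition pingpong (G : groupType) (a b : G) : Prop :=
  exists U : set G, forall k g,
    (~ U g -> U (a ^+ k.+1 * g) /\ U (a^-1 ^+ k.+1 * g)) /\
    (U g -> ~ U (b ^+ k.+1 * g) /\ ~ U (b^-1 ^+ k.+1 * g)).

Section Pingpong.
Variables (G : groupType) (A : G -> bool).
Hypothesis nestA : nested A.
Hypothesis tfG : torsion_free G.
Hypothesis finA : forall u, finite_set (walls A u).
Implicit Types (u v x a b c : G).

(** The geodesics to [u^-(m+1)] and to [g] start differently, so nothing
    cancels in the product, whose geodesic starts like that of [u^(m+1)]. *)
Lemma absorb u g m : codir A u u -> ~ codir A u^-1 g ->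
  codir A u (u ^+ m.+1 * g).
Proof.
move=> uu nug.
have [x /andP[xu xum]] := power_codir nestA tfG finA m uu.
exists x; rewrite xu partsM xum /=.
apply: contra_notN nug => xg; apply: codir_trans => //.
  exact: power_codir (codirV uu).
by exists (x * u ^+ m.+1); rewrite expVgn partsV xum.
Qed.

(** Here [U] consists of the elements starting in the direction of [a] or of
    [a^-1]; the elements starting in the direction of [b] or of [b^-1] lie in
    its complement. *)
Lemma pingpong_transverse a b : codir A a a -> codir A b b ->
  ~ codir A a b -> ~ codir A a b^-1 -> ~ codir A a^-1 b ->
    ~ codir A a^-1 b^-1 -> pingpong a b.
Proof.
move=> aa bb n1 n2 n3 n4.
have aa' := codirV aa; have bb' := codirV bb.
exists [set g | codir A a g \/ codir A a^-1 g] => k g /=; split.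
  move=> /not_orP[na na']; split; [left | right]; apply: absorb => //.
  by rewrite invgK.
move=> U.
have nb : ~ codir A b g.
  move=> /codir_sym gb; case: U => ga; [apply: n1 | apply: n3]; exact:
    codir_trans gb.
have nb' : ~ codir A b^-1 g.
  move=> /codir_sym gb; case: U => ga; [apply: n2 | apply: n4]; exact:
    codir_trans gb.
have /codir_sym b1 : codir A b (b ^+ k.+1 * g) by exact: absorb.
have /codir_sym b2 : codir A b^-1 (b^-1 ^+ k.+1 * g) by apply: absorb;
  rewrite ?invgK.
by split=> -[] ag; [apply: n1 | apply: n3 | apply: n2 | apply: n4];
  apply: codir_trans ag _.
Qed.

Definition nzpow b c := exists k, c = b ^+ k.+1 \/ c = b^-1 ^+ k.+1.

Lemma nzpowV b c : nzpow b c -> nzpow b c^-1.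
Proof.
by case=> k [->|->]; exists k; [right|left]; rewrite -expVgn ?invgK.
Qed.

Lemma nzpow_neq1 b c : b <> 1 -> nzpow b c -> c <> 1.
Proof.
move=> b1 [k [->|->]] /tfG-/(_ isT) // /(congr1 (fun x => x^-1)).
by rewrite invgK invg1.
Qed.

Lemma parts0V c : (forall x, ~~ parts A c x) -> forall x, ~~ parts A c^-1 x.
Proof. by move=> c0 x; rewrite partsVr. Qed.

Lemma parts0X c n : (forall x, ~~ parts A c x) -> forall x,
  ~~ parts A (c ^+ n) x.
Proof.
move=> c0; elim: n => [|n IH] x; first by rewrite parts1.
by rewrite expgS partsM (negPf (c0 _)) IH.
Qed.

Lemma parts0_nzpow b c : (forall x, ~~ parts A b x) -> nzpow b c -> forall x,
  ~~ parts A c x.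
Proof. by move=> b0 [k [->|->]]; apply: parts0X => //; exact: parts0V. Qed.

(** An element crossing no wall fixes the base vertex, so it permutes the
    directions there. *)
Lemma codir_shift c u v : (forall x, ~~ parts A c x) -> codir A u v ->
  codir A (c * u) (c * v).
Proof.
move=> c0 [x xuv]; exists (x * c^-1).
by rewrite !partsM !mulgVK (negPf (c0 _)).
Qed.

(** A direction fixed by [c] is fixed by all its powers, and then each [c^k] is
    a quotient of two elements of the finite set [walls A u]. *)
Lemma codir_free c u : (forall x, ~~ parts A c x) -> c <> 1 -> codir A u u ->
  ~ codir A u (c * u).
Proof.
move=> c0 c1 uu ucu.
have H k : codir A u (c ^+ k * u).
  elim: k => [|k IH]; first by rewrite mul1g.
  by apply: (codir_trans nestA ucu); rewrite expgS -mulgA; exact: codir_shift.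
pose F := (fun z : G * G => z.1^-1 * z.2) @` (walls A u `*` walls A u).
apply: (@pow_escape G c F tfG c1); first exact/finite_image/finite_setX.
move=> k; have [x /andP[xu]] := H k.
rewrite partsM (negPf (parts0X k c0 x)) => xck.
by exists (x, x * c ^+ k) => //=; rewrite mulKg.
Qed.

(** Powers of [b] carry the directions of [a] and [a^-1] away from both: each
    from itself by [codir_free], from one another by assumption. *)
Lemma pingpong_elliptic_apart a b : b <> 1 -> (forall x, ~~ parts A b x) ->
  codir A a a ->
  (forall c, nzpow b c -> ~ codir A a^-1 (c * a)) -> pingpong a b.
Proof.
move=> b1 b0 aa good.
have aa' := codirV aa.
have good' c : nzpow b c -> ~ codir A a (c * a^-1).
  move=> bc aca; apply: (good c^-1 (nzpowV bc)); apply: codir_sym.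
  by have := codir_shift (parts0_nzpow b0 (nzpowV bc)) aca; rewrite mulKg.
exists [set g | codir A a g \/ codir A a^-1 g] => k g /=; split.
  move=> /not_orP[na na']; split; [left | right]; apply: absorb => //.
  by rewrite invgK.
move=> U.
have H c : nzpow b c -> ~ (codir A a (c * g) \/ codir A a^-1 (c * g)).
  move=> bc U'.
  have c0 := parts0_nzpow b0 bc; have c1 := nzpow_neq1 b1 bc.
  case: U => /codir_sym/(codir_shift c0) U; case: U' => U';
  have := codir_trans nestA U' U.
  - exact: codir_free.
  - exact: good.
  - exact: good'.
  - exact: codir_free.
by split; apply: H; exists k; [left|right].
Qed.

(** If some power [c] of [b] carries the direction of [a] to that of [a^-1],
    then [c * a] and its inverse start in the same direction, and no nontrivial
    power of [b] fixes it; so [c * a] can take the place of [a]. *)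
Lemma pingpong_elliptic a b : b <> 1 -> (forall x, ~~ parts A b x) ->
  codir A a a ->
  generates [set a; b] ->
  exists a', generates [set a'; b] /\ pingpong a' b.
Proof.
move=> b1 b0 aa gen.
have [[c [bc ac]]|/forallNP good] :=
  pselect (exists c, nzpow b c /\ codir A a^-1 (c * a));
  last first.
  exists a; split=> //; apply: pingpong_elliptic_apart => // c bc ac.
  by apply: (good c).
have c0 := parts0_nzpow b0 bc.
have dirE v : codir A (c * a)^-1 v -> codir A a^-1 v.
  by case=> x; rewrite invgM partsM (negPf (parts0V c0 _)) addbF; exists x.
exists (c * a); split.
  apply: (generates_pair gen) => H HM HV Hca Hb; split=> //.
  have HX n x : H x -> H (x ^+ n.+1).
    by move=> Hx; elim: n => // n IH; rewrite expgS; exact: HM.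
  have Hc : H c by case: bc => k [->|->]; apply: HX => //; exact: HV.
  by rewrite -[a](mulKg c); apply: HM => //; exact: HV.
have caca : codir A (c * a) (c * a) by exact: codir_shift.
apply: pingpong_elliptic_apart => // c' bc' /dirE /codir_sym r1.
have := codir_trans nestA r1 ac => /codir_sym.
by apply: codir_free => //;
  [exact: (parts0_nzpow b0 bc')|exact: nzpow_neq1 bc'].
Qed.

(** A letter [(d, s)] stands for a generator or its inverse, and [h l] is a
    wall crossed by the letter [l] and by no other one. Two of the four
    half-spaces behind these walls cannot meet, since the corresponding letters
    and [1] lie in the other three corners; so the letters act as in a Schottky
    group. *)
Lemma pingpong_schottky (y h : bool * bool -> G) :
  (forall d s : bool, y (d, ~~ s) = (y (d, s))^-1) ->
  (forall d s : bool, h (d, s) * y (d, s) = h (d, ~~ s)) ->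
  (forall l l', parts A (y l) (h l') = (l == l')) ->
  pingpong (y (true, true)) (y (false, true)).
Proof.
move=> yV hV spE.
have disj l l' g : l != l' -> parts A g (h l) -> ~~ parts A g (h l').
  move=> ll' gl; apply/negP => gl'.
  have E u x (b : bool) : parts A u x = b -> A (x * u) = A x (+) b
    by rewrite /parts => <-; rewrite addKb.
  apply: (@no_four_corners _ A nestA (h l) (h l') 1 (y l') (y l) g (A (h l))
    (A (h l')));
    rewrite ?mulg1 //.
  - by rewrite (E _ _ _ (spE l' l)) eq_sym (negPf ll') addbF.
  - by rewrite (E _ _ _ (spE l' l')) eqxx addbT.
  - by rewrite (E _ _ _ (spE l l)) eqxx addbT.
  - by rewrite (E _ _ _ (spE l l')) (negPf ll') addbF.
  - by rewrite (E _ _ _ gl) addbT.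
  - by rewrite (E _ _ _ gl') addbT.
have step d s g : ~~ parts A g (h (d, ~~ s)) ->
  parts A (y (d, s) * g) (h (d, s)).
  by move=> ng; rewrite partsM hV (negPf ng) spE eqxx.
have steps d s k g : ~~ parts A g (h (d, ~~ s)) ->
  parts A (y (d, s) ^+ k.+1 * g) (h (d, s)).
  move=> ng; elim: k => [|k IH]; first exact: step.
  rewrite expgS -mulgA; apply: step; apply: disj IH.
  by rewrite xpair_eqE eqxx; case: s {ng}.
have yV' d : (y (d, true))^-1 = y (d, false) by rewrite -yV.
exists [set g | parts A g (h (true, true)) \/ parts A g (h (true, false))] =>
  k g /=.
rewrite !yV'; split.
  by move=> /not_orP[/negP n1 /negP n2]; split; [left | right]; exact: steps.
have nV d s s' g' : parts A g' (h (d, s)) -> ~~ parts A g' (h (~~ d, s')).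
  by apply: disj; case: d s s' => [] [] [].
move=> U; have ng s : ~~ parts A g (h (false, s)) by case: U => /nV.
by split=> -[] /nV;
  [move=> /(_ true)|move=> /(_ true)|move=> /(_ false)|move=> /(_ false)];
  rewrite /= steps.
Qed.
End Pingpong.

(** * Cuts, lengths and base changes *)

(** For a nested [A], the distance between the base vertex and its image. *)
Definition norm (G : groupType) (A : G -> bool) (u : G) : nat :=
  ncard (walls A u).

(** Asking for finiteness at every [u], instead of at given generators, lets
    the same cut be measured with different generating pairs. *)
Definition cut (G : groupType) (A : G -> bool) : Prop :=
  [/\ forall u, finite_set (walls A u), infinite_set [set x | A x] &
      infinite_set [set x | ~~ A x]].

(** Comparing with all generating pairs is the Nielsen reduction of [a] and
    [b]; comparing with all cuts allows moving the base vertex, as [toggle]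
    does. *)
Definition lex_minimal (G : groupType) (A : G -> bool) (a b : G) : Prop :=
  [/\ cut A, generates [set a; b] &
      forall (A' : G -> bool) (a' b' : G), cut A' -> generates [set a'; b'] ->
        (norm A b <= norm A' b')%N /\
        (norm A' b' = norm A b -> norm A a <= norm A' a')%N].

Lemma ncard_cover (T : choiceType) (X Z W : set T) :
  finite_set Z -> finite_set W -> X `<=` Z `|` W ->
  (ncard X <= ncard Z + ncard W)%N.
Proof.
move=> fZ fW XZW; rewrite -(ncardUI fZ fW).
apply: leq_trans (leq_addr _ _); apply: ncard_sub => //.
by rewrite finite_setU.
Qed.

Section Norm.
Variables (G : groupType).
Implicit Types (A : G -> bool) (u v x : G).

Lemma ncard_mulr (X : set G) u : finite_set X ->
  ncard ((fun x => x * u) @` X) = ncard X.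
Proof. by move=> fX; apply: ncard_image => //; exact: mulIg. Qed.

Lemma wallsV A u : walls A u^-1 = (fun x => x * u) @` walls A u.
Proof.
apply/seteqP; split=> x; rewrite /walls /=.
  by rewrite partsVr => xu; exists (x * u^-1) => //; rewrite mulgVK.
by case=> y yu <-; rewrite partsV.
Qed.

Lemma normV A u : finite_set (walls A u) -> norm A u^-1 = norm A u.
Proof. by move=> fu; rewrite /norm wallsV ncard_mulr. Qed.

(** The walls between [u] and [v] are those that separate [1] from exactly one
    of them, and they are counted by [u^-1 * v] after a right translation. *)
Lemma norm_codir A u v : (forall w, finite_set (walls A w)) ->
  (norm A (u^-1 * v) + (ncard (walls A u `&` walls A v)).*2 = norm A u + norm A
    v)%N.
Proof.
move=> finA; pose D := [set x | parts A u x (+) parts A v x].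
have fD : finite_set D.
  apply: (@sub_finite_set _ _ (walls A u `|` walls A v)); last
    by rewrite finite_setU.
  by move=> x; rewrite /D /walls /=; case: (parts A u x) => /=; [left | right].
have -> : norm A (u^-1 * v) = ncard D.
  rewrite -(ncard_mulr u fD); congr ncard; apply/seteqP; split=> x.
    by rewrite /walls /= partsM partsVr => xD; exists (x * u^-1);
      rewrite ?mulgVK.
  by case=> y; rewrite /D /walls /= => yD <-; rewrite partsM partsVr mulgK.
have fI : finite_set (walls A u `&` walls A v) by apply: finite_setIl.
have e1 := ncardUI (finA u) (finA v).
have e2 := ncardUI fD fI.
have e3 : D `|` (walls A u `&` walls A v) = walls A u `|` walls A v.
  apply/seteqP; split=> x; rewrite /D /walls /=;
    case: (parts A u x); case: (parts A v x) => /=; intuition.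
have e4 : ncard (D `&` (walls A u `&` walls A v)) = 0%N.
  rewrite (_ : _ `&` _ = set0) ?/ncard ?fset_set0//.
  apply/seteqP; split=> x //; rewrite /D /walls /=.
  by case: (parts A u x); case: (parts A v x) => /= -[] // _ [].
by rewrite /norm -e1 -e3 -[ncard (_ `|` _)]addn0 -e4 e2 -addnn addnA.
Qed.

(** In the tree, this moves the base vertex across the edge [x0]. *)
Definition toggle (x0 : G) A : G -> bool := fun x => A x (+) (x == x0).

Lemma parts_toggle x0 A u x :
  parts (toggle x0 A) u x = parts A u x (+) (x == x0) (+) (x * u == x0).
Proof.
rewrite /parts /toggle; move: (A _) (A _) (_ == _) (_ == _).
by move=> [] [] [] [].
Qed.

Lemma finite_walls_toggle x0 A u : finite_set (walls A u) ->
  finite_set (walls (toggle x0 A) u).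
Proof.
move=> fu; apply: (@sub_finite_set _ _ (walls A u `|` [set x0; x0 * u^-1])).
  move=> x; rewrite /walls /= parts_toggle.
  have [->|_] := eqVneq x x0; first by right; left.
  have [<-|_] := eqVneq (x * u) x0; first by right; right; rewrite mulgK.
  by rewrite !addbF; left.
by rewrite finite_setU; split.
Qed.

Lemma cut_toggle x0 A : cut A -> cut (toggle x0 A).
Proof.
case=> fA iA iA'; split=> [u||]; first exact: finite_walls_toggle.
- apply: sub_infinite_set (infinite_setD iA (finite_set1 x0)).
  by move=> x [/= Ax /eqP nx]; rewrite /toggle Ax (negPf nx).
- apply: sub_infinite_set (infinite_setD iA' (finite_set1 x0)).
  by move=> x [/= Ax /eqP nx]; rewrite /toggle (negPf Ax) (negPf nx).
Qed.

(** A wall on the ways to both [u] and [u^-1] is crossed twice by [u], at its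
    beginning and, translated, at its end; both crossings disappear. *)
Lemma norm_toggle_lt x0 A u : finite_set (walls A u) ->
  parts A u x0 -> parts A u^-1 x0 -> (norm (toggle x0 A) u < norm A u)%N.
Proof.
move=> fu xu xV.
have u1 : (x0 * u == x0) = false.
  by apply: contraTF xu => /eqP; rewrite -[RHS]mulg1 => /mulgI ->;
    rewrite parts1.
apply: (@ncard_lt _ _ _ x0) => //=; last first.
  by rewrite /walls /= parts_toggle xu eqxx u1.
move=> x; rewrite /walls /= parts_toggle.
have [->|_] := eqVneq x x0; first by rewrite xu.
have [xux0|_] := eqVneq (x * u) x0; last by rewrite !addbF.
by rewrite -(partsV A u x) xux0 xV.
Qed.

(** The crossing at one end disappears, and at most one appears at the other. *)
Lemma norm_toggle_le1 x0 A u : finite_set (walls A u) ->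
  parts A u x0 -> (norm (toggle x0 A) u <= norm A u)%N.
Proof.
move=> fu xu.
have u1 : (x0 * u == x0) = false.
  by apply: contraTF xu => /eqP; rewrite -[RHS]mulg1 => /mulgI ->;
    rewrite parts1.
have nx0 : ~~ parts (toggle x0 A) u x0 by rewrite parts_toggle xu eqxx u1.
have := @ncard_exchange _ (walls (toggle x0 A) u) [set x0] (walls A u)
  [set x0 * u^-1] fu
  (finite_set1 _).
rewrite /ncard !fset_set1 !cardfs1 !addn1 ltnS; apply.
- move=> x [|->]; last by left.
  rewrite /walls /= parts_toggle.
  have [->|_] := eqVneq x x0; first by left.
  have [<-|_] := eqVneq (x * u) x0; first by right; rewrite mulgK.
  by rewrite !addbF; left.
- by move=> x [/= xs xx0]; move: xs nx0; rewrite /walls /= xx0 => ->.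
Qed.

Lemma norm_toggle_le x0 A u : finite_set (walls A u) ->
  parts A u x0 || parts A u^-1 x0 -> (norm (toggle x0 A) u <= norm A u)%N.
Proof.
move=> fu /orP[xu|xu]; first exact: norm_toggle_le1.
have fV : finite_set (walls A u^-1) by rewrite wallsV; exact: finite_image.
have := norm_toggle_le1 fV xu; rewrite !normV//.
exact: finite_walls_toggle.
Qed.
End Norm.

Section LexMinimal.
Variable G : groupType.
Implicit Types (A : G -> bool) (a b x : G).

Lemma lex_minimalVl A a b : lex_minimal A a b -> lex_minimal A a^-1 b.
Proof.
case=> cA gen minA; split=> //.
  apply: (generates_pair gen) => H _ HV Ha Hb; split=> //.
  by rewrite -[a]invgK; exact: HV.
by case: (cA) => fA _ _; rewrite normV.
Qed.

Lemma lex_minimalVr A a b : lex_minimal A a b -> lex_minimal A a b^-1.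
Proof.
case=> cA gen minA; split=> //.
  apply: (generates_pair gen) => H _ HV Ha Hb; split=> //.
  by rewrite -[b]invgK; exact: HV.
by case: (cA) => fA _ _; rewrite normV.
Qed.

(** Otherwise [b] becomes shorter when the base vertex moves across [x]. *)
Lemma lex_minimal_disj A a b x : lex_minimal A a b ->
  parts A b x -> ~~ parts A b^-1 x.
Proof.
case=> cA gen minA xb; apply/negP => xV.
have fA : forall u, finite_set (walls A u) by case: cA.
have := norm_toggle_lt (fA b) xb xV; rewrite ltnNge.
by have [-> _] := minA _ a b (cut_toggle x cA) gen.
Qed.

(** Otherwise [a] becomes shorter, and [b] no longer, when the base vertex
    moves across [x]. *)
Lemma lex_minimal_avoid A a b x : lex_minimal A a b ->
  parts A b x -> parts A a x -> ~~ parts A a^-1 x.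
Proof.
case=> cA gen minA xb xa; apply/negP => xV.
have fA : forall u, finite_set (walls A u) by case: cA.
have := norm_toggle_lt (fA a) xa xV; rewrite ltnNge.
have [le1 le2] := minA _ a b (cut_toggle x cA) gen.
rewrite le2 //; apply/eqP; rewrite eqn_leq le1 andbT.
by apply: norm_toggle_le => //; rewrite xb.
Qed.
End LexMinimal.

(** * Existence of nested cuts *)

(** A limit point of [M] in the compact space of subsets of [T], taken along an
    ultrafilter that contains [M] and no finite set. *)
Lemma accumulation (T : eqType) (M : set (T -> bool)) : infinite_set M ->
  exists A : T -> bool, forall D : seq T,
    infinite_set (M `&` [set B | forall x, x \in D -> B x = A x]).
Proof.
move=> infM; pose F : set_system (T -> bool) := [set P | finite_set (M `\` P)].
have FF : ProperFilter F.
  apply: Build_ProperFilter; first by rewrite /F /= setD0.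
  split.
  - by rewrite /F /= setDT.
  - by move=> P Q FP FQ; rewrite /F /= setDIr finite_setU.
  - by move=> P Q PQ; apply: sub_finite_set => B [MB nQ]; split=> // /PQ.
have [U [UU FU]] := ultraFilterLemma FF.
have UF : Filter U by case: UU => -[].
pose A x := `[< U [set B : T -> bool | B x] >].
exists A => D finMD.
have UD : U [set B | forall x, x \in D -> B x = A x].
  elim: D {finMD} => [|d D IH]; first by apply: filterS filterT => B.
  have Ud : U [set B | B d = A d].
    rewrite /A; case: asboolP => [//|nUd].
    have [//|] := in_ultra_setVsetC [set B : T -> bool | B d] UU.
    by apply: filterS => B /= /negP/negbTE.
  apply: filterS (filterI Ud IH) => B [/= Bd BD] x.
  by rewrite inE => /predU1P[->|/BD].
have UM : U M by apply: FU; rewrite /F /= setDv.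
have UN : U (~` (M `&` [set B | forall x, x \in D -> B x = A x])).
  by apply: FU; rewrite /F /= setDE setCK; apply: sub_finite_set finMD => B [].
have [B [[UB MB] nB]] := filter_ex (filterI (filterI UD UM) UN).
exact: nB.
Qed.

Definition neg (T : Type) (A : T -> bool) : T -> bool := fun x => ~~ A x.
Definition meet (T : Type) (A B : T -> bool) : T -> bool := fun x => A x && B x.
Definition join (T : Type) (A B : T -> bool) : T -> bool := fun x => A x || B x.

Section Cross.
Variable T : Type.
Implicit Types A B C : T -> bool.

Lemma cross_sym A B : cross A B -> cross B A.
Proof.
by case=> [[p]] + [q] + [r] + [s]; rewrite andbC => + + + => p1 q1 r1 s1;
  split; [exists p | exists r | exists q | exists s]; rewrite // andbC.
Qed.

Lemma negK A : neg (neg A) = A.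
Proof. by apply: funext => x; rewrite /neg negbK. Qed.

Lemma cross_neg A B : cross A B -> cross (neg A) B.
Proof.
case=> [[p p1] [q q1] [r r1] [s s1]].
by split; [exists r | exists s | exists p | exists q]; rewrite /neg ?negbK.
Qed.

Lemma cross_negE A B : cross (neg A) B = cross A B.
Proof.
apply/propext; split; last exact: cross_neg.
by move=> /cross_neg; rewrite negK.
Qed.

Lemma join_meet A B : join A B = neg (meet (neg A) (neg B)).
Proof. by apply: funext => x; rewrite /neg /meet /join negb_and !negbK. Qed.

(** The crossing of [A] and [B] supplies a point [t] outside both. It is needed
    when the two witnesses outside [meet A B] lie one outside [A], the other
    outside [B]. *)
Lemma cross_meet A B C : cross A B -> cross (meet A B) C ->
  cross A C \/ cross B C.
Proof.
rewrite /meet => -[_ _ _ [t /andP[tA tB]]] [[p /andP[/andP[pA pB] pC]]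
  [q /andP[/andP[qA qB] qC]] [r /andP[rAB rC]] [s /andP[sAB sC]]].
have HA x y : ~~ A x -> C x -> ~~ A y -> ~~ C y -> cross A C.
  by move=> x1 x2 y1 y2; split; [exists p|exists q|exists x|exists y];
    apply/andP.
have HB x y : ~~ B x -> C x -> ~~ B y -> ~~ C y -> cross B C.
  by move=> x1 x2 y1 y2; split; [exists p|exists q|exists x|exists y];
    apply/andP.
have [tC|tC] := boolP (C t).
  by move: sAB; rewrite negb_and => /orP[sA|sB];
    [left; apply: (HA t s)|right; apply: (HB t s)].
by move: rAB; rewrite negb_and => /orP[rA|rB];
  [left; apply: (HA r t)|right; apply: (HB r t)].
Qed.

Lemma cross_join A B C : cross A B -> cross (join A B) C ->
  cross A C \/ cross B C.
Proof.
rewrite join_meet cross_negE => AB.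
have AB' : cross (neg A) (neg B)
  by apply/cross_neg/cross_sym/cross_neg/cross_sym.
by move=> /(cross_meet AB'); rewrite !cross_negE.
Qed.

Lemma cross_meet_join A B C : cross (meet A B) C -> cross (join A B) C ->
  cross A C /\ cross B C.
Proof.
rewrite /meet /join =>
  -[[p /andP[/andP[pA pB] pC]] [q /andP[/andP[qA qB] qC]] _ _].
move=> [_ _ [r /andP[]]]; rewrite negb_or => /andP[rA rB] rC.
move=> [s /andP[]]; rewrite negb_or => /andP[sA sB] sC.
by split; split;
  [exists p|exists q|exists r|exists s|exists p|exists q|exists r|exists s];
  apply/andP.
Qed.

Lemma cross_meet_id A B : ~ cross (meet A B) B.
Proof. by case=> _ [x] + _ _; rewrite /meet => /andP[/andP[_ ->]]. Qed.

Lemma cross_join_id A B : ~ cross (join A B) B.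
Proof. by case=> _ _ [x] + _; rewrite /join negb_or =>
  /andP[/andP[_ /negbTE->]]. Qed.
End Cross.

Section Nested.
Variables (G : groupType) (a b : G) (w : nat).
Hypothesis gen : generates [set a; b].
Implicit Types (A B C : G -> bool) (u x : G).

Lemma generates_const A : (forall x, ~~ parts A a x) ->
  (forall x, ~~ parts A b x) ->
  forall x y, A x = A y.
Proof.
move=> na nb.
suff H u : forall x, A (x * u) = A x by move=> x y;
  rewrite -(H (x^-1 * y) x) mulVKg.
apply: (generates_ind (P := fun u => forall x, A (x * u) = A x) gen).
- by move=> x; rewrite mulg1.
- by move=> v v' ev ew x; rewrite mulgA ew ev.
- by move=> v ev x; rewrite -[in RHS](mulgVK v x) ev.
- move=> _ [->|->] x.
    by have := na x; rewrite /parts; do 2!case: (A _).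
  by have := nb x; rewrite /parts; do 2!case: (A _).
Qed.

Lemma generates_finite_walls A (S : set G) : generates S ->
  (forall u, S u -> finite_set (walls A u)) -> forall u, finite_set (walls A u).
Proof.
move=> genS fS; apply:
  (generates_ind (P := fun u => finite_set (walls A u)) genS) => //.
- have -> : walls A 1 = set0 by apply/seteqP; split=> x //;
  rewrite /walls /= parts1.
  exact: finite_set0.
- move=> u v fu fv; apply:
  (@sub_finite_set _ _ (walls A u `|` (fun x => x * u^-1) @` walls A v)).
    move=> x; rewrite /walls /= partsM.
    have [xu _|xu xv] := boolP (parts A u x); first by left.
    by right; exists (x * u) => //; rewrite mulgK.
  by rewrite finite_setU; split=> //; exact: finite_image.
- by move=> u fu; rewrite wallsV; exact: finite_image.
Qed.

(** For [w] large enough, minimising this number minimises [norm A b] first and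
    [norm A a] second. *)
Definition cost A : nat := (w.+1 * norm A b + norm A a)%N.

Lemma parts_neg A u x : parts (neg A) u x = parts A u x.
Proof. by rewrite /parts /neg addbN addNb negbK. Qed.

Lemma walls_neg A u : walls (neg A) u = walls A u.
Proof. by apply/seteqP; split=> x; rewrite /walls /= parts_neg. Qed.

Lemma cost_neg A : cost (neg A) = cost A.
Proof. by rewrite /cost /norm !walls_neg. Qed.

Lemma cut_neg A : cut A -> cut (neg A).
Proof.
case=> fA iA iA'; split=> // [u|]; first by rewrite walls_neg.
by rewrite (_ : [set x | _] = [set x | A x])//; apply/seteqP; split=> x /=;
  rewrite /neg negbK.
Qed.

Lemma walls_translate h A u :
  walls (translate h A) u = (fun x => h * x) @` walls A u.
Proof.
apply/seteqP; split=> x; rewrite /walls /= /parts /translate mulgA.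
  by move=> hx; exists (h^-1 * x); rewrite ?mulVKg.
by case=> y yu <-; rewrite mulKg.
Qed.

Lemma translate_image h A :
  [set x | translate h A x] = (fun x => h * x) @` [set x | A x].
Proof.
apply/seteqP; split=> x; rewrite /= /translate.
  by move=> hx; exists (h^-1 * x); rewrite ?mulVKg.
by case=> y yu <-; rewrite mulKg.
Qed.

Lemma infinite_translate h (X : set G) : infinite_set X ->
  infinite_set ((fun x => h * x) @` X).
Proof.
move=> iX /(finite_image (fun x => h^-1 * x)).
suff -> : (fun x => h^-1 * x) @` ((fun x => h * x) @` X) = X by [].
apply/seteqP; split=> x; first by case=> _ [y Xy <-] <-; rewrite mulKg.
by move=> Xx; exists (h * x); [exists x | rewrite mulKg].
Qed.

Lemma cut_translate h A : cut A -> cut (translate h A).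
Proof.
case=> fA iA iA'; split=> [u||].
- by rewrite walls_translate; exact: finite_image.
- by rewrite translate_image; exact: infinite_translate.
- have := translate_image h (neg A); rewrite /neg {1}/translate => ->.
  exact: infinite_translate.
Qed.

Lemma cost_translate h A : cut A -> cost (translate h A) = cost A.
Proof.
case=> fA _ _; rewrite /cost /norm !walls_translate !ncard_image//; exact:
  mulgI.
Qed.

(** Serves to compare a cut with its pieces, and two cuts with their symmetric
    difference. *)
Lemma cost_split A B C : (forall u, finite_set (walls A u)) ->
  (forall u, finite_set (walls B u)) ->
  (forall u x, u = a \/ u = b ->
     parts C u x = parts A u x || parts B u x /\ ~~
       (parts A u x && parts B u x)) ->
  cost C = (cost A + cost B)%N.
Proof.
move=> fA fB H.
have E u : u = a \/ u = b -> norm C u = (norm A u + norm B u)%N.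
  move=> uab; rewrite /norm -(ncardUI (fA u) (fB u)).
  have -> : walls A u `&` walls B u = set0.
    by apply/seteqP; split=> x //; have [_ /negP n] := H u x uab; case=> xA xB;
      apply: n; apply/andP.
  rewrite [ncard set0]/ncard fset_set0 addn0; congr ncard.
  by apply/seteqP; split=> x; have [Ex _] := H u x uab; rewrite /walls /= Ex =>
    /orP.
have Ea := E a (or_introl erefl); have Eb := E b (or_intror erefl).
by rewrite /cost Ea Eb; lia.
Qed.

Variable c : nat.
Hypothesis cost_min : forall A, cut A -> (c <= cost A)%N.

Definition narrow A := cut A /\ cost A = c.

Lemma cost_const A : (forall u, finite_set (walls A u)) -> cost A = 0%N ->
  forall x y, A x = A y.
Proof.
move=> fA; rewrite /cost => c0; have [na nb] : norm A a = 0%N /\ norm A b = 0%N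
  by lia.
apply: generates_const => x; apply/negP => xs; have : set0 x.
- by rewrite -(ncard_eq0 (fA a) na).
- by [].
- by rewrite -(ncard_eq0 (fA b) nb).
- by [].
Qed.

Definition endpoints A : set G :=
  walls A a `|` walls A b `|` (fun x => x * a) @` walls A a `|` (fun x =>
    x * b) @` walls A b.

Lemma finite_endpoints A : finite_set (walls A a) -> finite_set (walls A b) ->
  finite_set (endpoints A).
Proof. by move=> fa fb; rewrite /endpoints !finite_setU; do !split=> //; exact:
  finite_image. Qed.

Lemma endpointsP A u x : u = a \/ u = b -> parts A u x ->
  endpoints A x /\ endpoints A (x * u).
Proof.
by case=> -> xu; split;
  [left; left; left | left; right; exists x | left; left; right | right;
  exists x].
Qed.

(** Since [B] agrees with [A] at both ends of every wall of [A], the walls of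
    their symmetric difference [C] are the walls of [B] that are not walls of
    [A], so that [C] costs less than [c] and is no cut. Then [A] differs from
    [B] or from the complement of [B] by a finite set, hence is a cut and costs
    at least [c], which leaves nothing for [C]. *)
Lemma limit_narrow A B : (forall u, finite_set (walls A u)) -> narrow B ->
  (forall x, endpoints A x -> B x = A x) -> (exists x, endpoints A x) -> B = A.
Proof.
move=> fA [[fB iB iB'] cB] BA [x0 x0A].
pose C x := A x (+) B x.
have spC u x : parts C u x = parts A u x (+) parts B u x.
  by rewrite /parts /C; move: (A _) (A _) (B _) (B _) => [] [] [] [].
have AB u x : u = a \/ u = b -> parts A u x -> parts B u x.
  by move=> uab xu; have [e1 e2] := endpointsP uab xu; rewrite /parts !BA.
have fC u : finite_set (walls C u).
  apply: (@sub_finite_set _ _ (walls A u `|` walls B u)); last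
    by rewrite finite_setU.
  by move=> x; rewrite /walls /= spC; case: (parts A u x) => /=; [left | right].
have cE : cost B = (cost C + cost A)%N.
  apply: cost_split => // u x uab; have := AB u x uab; rewrite spC.
  by case: (parts A u x) (parts B u x) => [] [] // /(_ isT).
have A_gt0 : (0 < cost A)%N.
  rewrite lt0n; apply/eqP => cA0; have cA := cost_const fA cA0.
  have spA0 u x : parts A u x = false by rewrite /parts (cA (x * u) x) addbb.
  by case: x0A => [[[]|]|]; rewrite /walls /= ?spA0 // => -[y]; rewrite spA0.
have cutA : cut A.
  have [finC|infC] := pselect (finite_set [set x | C x]).
    split=> //.
      apply: sub_infinite_set (infinite_setD iB finC) => x [/= Bx].
      by rewrite /C Bx; case: (A x).
    apply: sub_infinite_set (infinite_setD iB' finC) => x [/= Bx].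
    by rewrite /C (negPf Bx); case: (A x).
  have [finC'|infC'] := pselect (finite_set [set x | ~~ C x]).
    split=> //.
      apply: sub_infinite_set (infinite_setD iB' finC') => x [/= Bx].
      by rewrite /C (negPf Bx); case: (A x).
    apply: sub_infinite_set (infinite_setD iB finC') => x [/= Bx].
    by rewrite /C Bx; case: (A x).
  have cutC : cut C by split.
  by have := cost_min cutC; lia.
have C0 : cost C = 0%N by have := cost_min cutA; lia.
apply: funext => x; have := cost_const fC C0 x x0.
by rewrite /C (BA x0 x0A) addbb; case: (A x) (B x) => [] [].
Qed.

(** The family accumulates at a set [A] with at most [c] walls for each
    generator. If [A] had a wall, then by [limit_narrow] all members of the
    family close to [A] would be equal to it. So [A] is empty or everything,
    and members of the family close to [A] are constant on [D]. *)
Lemma narrow_compact (M : set (G -> bool)) : infinite_set M -> M `<=` narrow ->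
  forall D : set G, finite_set D -> exists B c', M B /\ forall x, D x ->
    B x = c'.
Proof.
move=> infM narM D finD.
have [A Aacc] := accumulation infM.
have pick (E : set G) : finite_set E ->
    infinite_set (M `&` [set B | forall x, E x -> B x = A x]).
  move=> finE; apply: sub_infinite_set (Aacc (fset_set E)) => B [MB BA]; split=>
    // x Ex.
  by apply: BA; rewrite in_fset_set// inE.
have bound u : u = a \/ u = b -> finite_set (walls A u).
  move=> uab; apply: contrapT => infu.
  have [X XA sX] := infinite_set_fset c.+1 infu.
  have fX : finite_set [set` X] by exact: finite_fset.
  have fE : finite_set ([set` X] `|` (fun x => x * u) @` [set` X]).
    by rewrite finite_setU; split=> //; exact: finite_image.
  have [B [MB BA]] := infinite_setN0 (pick _ fE).
  have [[fB _ _] cB] := narM B MB.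
  have XB : [set` X] `<=` walls B u.
    move=> x xX; rewrite /walls /= /parts !BA;
      [exact: XA | right; exists x | left]; done.
  have := ncard_sub (fB u) XB; rewrite /ncard set_fsetK => le1.
  have le2 : (norm B u <= cost B)%N by rewrite /cost; case: uab => ->; lia.
  rewrite /norm /ncard in le2; lia.
have fA : forall u, finite_set (walls A u).
  by apply: (generates_finite_walls gen) => u uab; apply: bound.
have fEA := finite_endpoints (fA a) (fA b).
have [[x0 x0A]|/forallNP noendpoints] := pselect (exists x, endpoints A x).
  case: (pick _ fEA); apply: (@sub_finite_set _ _ [set A]) => // B [MB BA].
  by apply: limit_narrow => //; [exact: narM | exists x0].
have cA : forall x y, A x = A y.
  apply: generates_const => x; apply/negP => xs; apply: (noendpoints x).
    by have [] := endpointsP (or_introl erefl) xs.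
  by have [] := endpointsP (or_intror erefl) xs.
have [B [MB BA]] := infinite_setN0 (pick _ finD).
by exists B, (A 1); split=> // x /BA ->.
Qed.

Lemma narrow_neg A : narrow A -> narrow (neg A).
Proof. by case=> cA cc; split; [exact: cut_neg | rewrite cost_neg]. Qed.

Definition crossers A : set (G -> bool) := [set B | narrow B /\ cross A B].

(** Otherwise [narrow_compact] gives a crosser [B] of [A] that, up to
    complementation, avoids the ends of all walls of [A]. Then the walls of [B]
    are shared out between its parts inside and outside [A]. One part is
    infinite, hence a cut and as costly as [B], so the other costs nothing and
    is empty, although [A] and [B] cross. *)
Lemma finite_crossers A : narrow A -> finite_set (crossers A).
Proof.
move=> [[fA iA iA'] cA]; apply: contrapT => infX.
have [|B [c' [[narB AB] BD]]] :=
  narrow_compact infX _ (finite_endpoints (fA a) (fA b)).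
  by move=> B [].
have {B c' BD narB AB} [B [narB AB B0]] : exists B, [/\ narrow B, cross A B &
    forall x, endpoints A x -> B x = false].
  case: c' BD => BD; last by exists B.
  exists (neg B); split=> [||x /BD xB]; first exact: narrow_neg.
    by apply/cross_sym/cross_neg/cross_sym.
  by rewrite /neg xB.
have [[fB iB iB'] cB] := narB.
pose B1 := meet B A; pose B2 := meet B (neg A).
have fm (C : G -> bool) u : finite_set (walls C u) ->
  finite_set (walls (meet B C) u).
  move=> fC; apply: (@sub_finite_set _ _ (walls B u `|` walls C u)); last
    by rewrite finite_setU.
  move=> x; rewrite /walls /= /parts /meet.
  by case: (B x) (B (x * u)) => [] [] /=; [right | left | left | ].
have fB1 u : finite_set (walls B1 u) by exact: fm.
have fB2 u : finite_set (walls B2 u) by apply: fm; rewrite walls_neg.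
have cE : cost B = (cost B1 + cost B2)%N.
  apply: cost_split => // u x uab.
  have [xu|nxu] := boolP (parts A u x).
    have [x1 x2] := endpointsP uab xu.
    by rewrite /B1 /B2 /meet /parts !B0.
  have -> : parts B1 u x = A x && parts B u x.
    by move: nxu; rewrite /parts /B1 /meet; case:
      (A x) (A (x * u)) (B x) (B (x * u)) => [] [] [] [].
  have -> : parts B2 u x = ~~ A x && parts B u x.
    move: nxu; rewrite /parts /B2 /meet /neg.
    by case: (A x) (A (x * u)) (B x) (B (x * u)) => [] [] [] [].
  by case: (A x) (parts B u x) => [] [].
have B1B x : B1 x -> B x by case/andP.
have B2B x : B2 x -> B x by case/andP.
have key C C' : (forall u, finite_set (walls C u)) ->
  (forall u, finite_set (walls C' u)) ->
    (forall x, C x -> B x) -> (forall x, C' x -> B x) ->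
      cost B = (cost C + cost C')%N ->
    (exists x, C' x) -> finite_set [set x | C x].
  move=> fC fC' CB C'B cE' [y yC']; apply: contrapT => infC.
  have cutC : cut C.
    split=> //; apply: sub_infinite_set iB' => x /=; apply: contra; exact: CB.
  have C'0 : cost C' = 0%N by have := cost_min cutC; lia.
  have [z /= zB] := infinite_setN0 iB'.
  by move: zB; rewrite C'B// (cost_const fC' C'0 z y).
have [[p p1] _ [q q1] _] := AB.
apply: iB; apply: (@sub_finite_set _ _ ([set x | B1 x] `|` [set x | B2 x])).
  move=> x /= Bx; have [Ax|nAx] := boolP (A x); first by left;
    rewrite /B1 /meet Bx.
  by right; rewrite /B2 /meet /neg Bx.
rewrite finite_setU; split.
  by apply: (key B1 B2) => //; exists q; rewrite /B2 /meet /neg andbC.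
by apply: (key B2 B1) => //;
  [rewrite addnC | exists p; rewrite /B1 /meet andbC].
Qed.

Lemma submodular A B u : finite_set (walls A u) -> finite_set (walls B u) ->
  (norm (meet A B) u + norm (join A B) u <= norm A u + norm B u)%N.
Proof.
move=> fA fB; apply: ncard_exchange => // x;
  rewrite /walls /= /parts /meet /join;
  case: (A x) (A (x * u)) (B x) (B (x * u)) => [] [] [] [] /=; intuition.
Qed.

(** The two corners are cuts whose costs add up to at most [2 * c], so both are
    narrow. What crosses one of them crosses [A] or [B], what crosses both
    crosses both [A] and [B], and [B] crosses [A] but neither corner. *)
Lemma uncross A B : narrow A -> narrow B -> cross A B ->
  infinite_set [set x | A x && B x] ->
    infinite_set [set x | ~~ A x && ~~ B x] ->
  [/\ narrow (meet A B), narrow (join A B) &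
    (ncard (crossers (meet A B)) + ncard (crossers (join A B)) <
     ncard (crossers A) + ncard (crossers B))%N].
Proof.
move=> narA narB AB i1 i2.
have [[fA iA iA'] cA] := narA; have [[fB iB iB'] cB] := narB.
have f2 (C : G -> bool) u :
    (forall x, parts C u x -> parts A u x \/ parts B u x) ->
      finite_set (walls C u).
  by move=> H; apply: (@sub_finite_set _ _ (walls A u `|` walls B u)) => //;
    rewrite finite_setU.
have cut1 : cut (meet A B).
  split=> // [u|].
    apply: f2 => x; rewrite /parts /meet.
    by case: (A x) (A (x * u)) (B x) (B (x * u)) => [] [] [] [] /=; intuition.
  by apply: sub_infinite_set iA' => x /=; rewrite /meet negb_and => ->.
have cut2 : cut (join A B).
  split=> // [u||].
  - apply: f2 => x; rewrite /parts /join.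
    by case: (A x) (A (x * u)) (B x) (B (x * u)) => [] [] [] [] /=; intuition.
  - by apply: sub_infinite_set iA => x /=; rewrite /join => ->.
  - by apply: sub_infinite_set i2 => x /=; rewrite /join negb_or.
have c1 := cost_min cut1; have c2 := cost_min cut2.
have := submodular (fA a) (fB a); have := submodular (fA b) (fB b) => sb sa.
have csub : (cost (meet A B) + cost (join A B) <= cost A + cost B)%N.
  rewrite /cost; nia.
have nar1 : narrow (meet A B) by split=> //; lia.
have nar2 : narrow (join A B) by split=> //; lia.
split=> //; apply: (@ncard_exchange_lt _ _ _ _ _ B); try exact: finite_crossers.
- move=> C [[narC]|[narC]]; [move=> /(cross_meet AB) | move=> /(cross_join AB)];
  by case=> cr; [left | right].
- by move=> C [[narC m] [_ j]]; have [] := cross_meet_join m j.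
- by [].
- by case=> _ /cross_meet_id.
- by case=> _ /cross_join_id.
Qed.

Lemma crossers_translate h A : narrow A ->
  (ncard (crossers (translate h A)) <= ncard (crossers A))%N.
Proof.
move=> narA.
have fX := finite_crossers narA.
apply: leq_trans (ncard_image_le (translate h) fX).
apply: ncard_sub; first exact: finite_image.
move=> B [narB [[p p1] [q q1] [r r1] [s s1]]]; exists (translate h^-1 B).
  have [cB ccB] := narB; split.
    by split; [exact: cut_translate | rewrite cost_translate].
  by split; [exists (h^-1 * p)|exists (h^-1 * q)|exists (h^-1 * r)|exists
    (h^-1 * s)];
    rewrite /translate invgK mulVKg.
by apply: funext => x; rewrite /translate invgK mulVKg.
Qed.

Lemma crossers_neg A : crossers (neg A) = crossers A.
Proof. by apply/seteqP; split=> B; rewrite /crossers /= cross_negE. Qed.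

(** A narrow cut [A] crossed by the fewest narrow cuts is nested: if it crossed
    a translate, which is crossed by as few, two opposite corners would be
    infinite, and one of them would be crossed by fewer. *)
Lemma nested_narrow : (exists A, narrow A) -> exists A, narrow A /\ nested A.
Proof.
move=> [A0 nar0].
have ex : exists n, `[< exists A, narrow A /\ ncard (crossers A) = n >].
  by exists (ncard (crossers A0)); apply/asboolP; exists A0.
case: (ex_minnP ex) => n /asboolP[A [narA An]] nmin.
have {}nmin B : narrow B -> (n <= ncard (crossers B))%N.
  by move=> narB; apply: nmin; apply/asboolP; exists B.
exists A; split=> // h.
have narT : narrow (translate h A).
  by case: (narA) => cA ccA; split;
    [exact: cut_translate | rewrite cost_translate].
have leT := crossers_translate h narA.
set T := translate h A in narT leT *.
have contra_ B : narrow B -> cross A B ->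
  (ncard (crossers B) <= ncard (crossers A))%N ->
    infinite_set [set x | A x && B x] ->
      infinite_set [set x | ~~ A x && ~~ B x] -> False.
  move=> narB AB leB i1 i2; have [n1 n2] := uncross narA narB AB i1 i2.
  by have := nmin _ n1; have := nmin _ n2; lia.
move=> AT.
have [[_ iA iA'] _] := narA; have [[_ iT iT'] _] := narT.
have [f1|i1] := pselect (finite_set [set x | A x && T x]); last first.
  have [f2|i2] := pselect (finite_set [set x | ~~ A x && ~~ T x]); last first.
    exact: (contra_ T).
  apply: (contra_ (neg T)).
  - exact: narrow_neg.
  - by apply/cross_sym/cross_neg/cross_sym.
  - by rewrite crossers_neg.
  - apply: sub_infinite_set (infinite_setD iT' f2) => x [/= nT].
    by rewrite /neg nT andbT => /negP; rewrite negbK => ->.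
  - apply: sub_infinite_set (infinite_setD iA' f2) => x [/= nA].
    by rewrite /neg nA => /negP.
apply: (contra_ (neg T)).
- exact: narrow_neg.
- by apply/cross_sym/cross_neg/cross_sym.
- by rewrite crossers_neg.
- apply: sub_infinite_set (infinite_setD iA f1) => x [/= ->].
  by rewrite /neg => /negP.
- apply: sub_infinite_set (infinite_setD iT f1) => x [/= Tx].
  by rewrite /neg Tx andbT => /negP ->.
Qed.
End Nested.

(** * Ping-pong from a minimal nested cut *)

Section Overlap.
Variables (G : groupType) (A : G -> bool) (a b : G).
Hypothesis nestA : nested A.
Hypothesis minA : lex_minimal A a b.
Hypothesis ab : codir A a b.
Hypothesis b_gt0 : (0 < norm A b)%N.

Let fA u : finite_set (walls A u). Proof. by case: minA => -[]. Qed.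

(* By minimality the directions of a, a^-1, b and b^-1 are distinct, except that
   a and b share theirs, and a^-1 and b^-1 possibly do. *)
Let bb' x : parts A b x -> ~~ parts A b^-1 x.
Proof. exact: lex_minimal_disj minA. Qed.

Let aa' x : parts A a x -> ~~ parts A a^-1 x.
Proof.
move=> xa; apply/negP => xa'; case: ab => y /andP[ya yb].
have [z [zb za za']] := codir_common nestA yb ya xa xa'.
by have := lex_minimal_avoid minA zb za; rewrite za'.
Qed.

Let a'b x : parts A a^-1 x -> ~~ parts A b x.
Proof.
move=> xa'; apply/negP => xb; case: ab => y /andP[ya yb].
have [z [za zb za']] := codir_common nestA ya yb xb xa'.
by have := lex_minimal_avoid minA zb za; rewrite za'.
Qed.

Let ab' x : parts A a x -> ~~ parts A b^-1 x.
Proof.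
move=> xa; apply/negP => xb'; case: ab => y /andP[ya yb].
have [z [zb za zb']] := codir_common nestA yb ya xa xb'.
by have := bb' zb; rewrite zb'.
Qed.

(** The walls lost to cancellation in [a^-1 * b] and in [a * b^-1]. *)
Let C1 := [set x | parts A a x && parts A b x].
Let C2 := [set x | parts A a^-1 x && parts A b^-1 x].
Let fC1 : finite_set C1.
Proof. by apply: sub_finite_set (fA a) => x /andP[]. Qed.
Let fC2 : finite_set C2.
Proof. by apply: sub_finite_set (fA a^-1) => x /andP[]. Qed.

Let C2_pull u :
  finite_set [set x | C2 (x * u)] /\ ncard [set x | C2 (x * u)] = ncard C2.
Proof.
have -> : [set x | C2 (x * u)] = (fun x => x * u^-1) @` C2.
  apply/seteqP; split=> x; last by case=> y yC <-; rewrite /= mulgVK.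
  by move=> xC; exists (x * u); rewrite ?mulgK.
by split; [exact: finite_image | exact: ncard_mulr].
Qed.

Let le_ba : (norm A b <= norm A a)%N.
Proof.
case: minA => cA gen m; have [] // := m A b a cA.
by apply: (generates_pair gen) => H _ _ Ha Hb.
Qed.

Let le_am a' : generates [set a'; b] -> (norm A a <= norm A a')%N.
Proof. by case: minA => cA gen m gen'; have [_] := m A a' b cA gen'; apply. Qed.

(** As [b^-1 * a] can replace [a] in the generating pair, it is not shorter. *)
Let C1_small : ((ncard C1).*2 <= norm A b)%N.
Proof.
have gen' : generates [set b^-1 * a; b].
  case: minA => _ gen _; apply: (generates_pair gen) => H HM HV Ha Hb; split=>
    //.
  by rewrite -[a](mulVKg b); apply: HM.
have := norm_codir b a fA; rewrite (_ : _ `&` _ = C1).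
  by have := le_am gen'; lia.
by apply/seteqP; split=> x; rewrite /C1 /walls /=; [case=> -> -> | case/andP].
Qed.

Let norm_ab' : (norm A (a * b^-1) + (ncard C2).*2 = norm A a + norm A b)%N.
Proof.
have := norm_codir b^-1 a^-1 fA; rewrite invgK !normV//.
have -> : norm A (b * a^-1) = norm A (a * b^-1) by rewrite -normV// invgM invgK.
rewrite (_ : _ `&` _ = C2); first by rewrite [(norm A b + _)%N]addnC.
by apply/seteqP; split=> x; rewrite /C2 /walls /=; [case=> -> -> | case/andP].
Qed.

Let gen_ab' : generates [set a * b^-1; b].
Proof.
case: minA => _ gen _; apply: (generates_pair gen) => H HM HV Ha Hb; split=> //.
by rewrite -[a](mulgVK b); apply: HM.
Qed.

Let C2_small : ((ncard C2).*2 <= norm A b)%N.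
Proof. by have := le_am gen_ab'; have := norm_ab'; lia. Qed.

(** The sets [C1] and [C2] take at most one half of [b] each. If both take
    exactly one half, then [a * b^-1] is as short as [a], and
    [lex_minimal_avoid] for the pair [(a * b^-1, b)] shows that [C2] is the
    right translate of [C1] by [a]. The initial segment [C1] of the geodesic to
    [a] is then also its final segment of the same length, hence all of it, and
    [a] is only half as long as [b], although it is not shorter. *)
Let overlap_small : (ncard C1 + ncard C2 < norm A b)%N.
Proof.
rewrite ltnNge; apply/negP => big.
have c12 : ncard C1 = ncard C2 by have := C1_small; have := C2_small; lia.
have [fC2b cC2b] := C2_pull b.
have E u x (c : bool) : parts A u x = c -> A (x * u) = A x (+) c.
  by rewrite /parts => <-; rewrite addKb.
(* In b the initial segment C1 and the final segment C2 do not overlap: they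
   would otherwise cover b, which two overlapping halves cannot. *)
have disj x : C1 x -> ~ C2 (x * b).
  move=> /andP[xa xb] /andP[xba' xbb'].
  have cover : walls A b `<=` C1 `|` [set x | C2 (x * b)].
    move=> h hb; rewrite /walls /= in hb.
    have [ha|nha] := boolP (parts A a h); first by left; rewrite /C1 /= ha.
    right; rewrite /C2 /= partsV hb andbT; apply/negPn/negP => nhba'.
    apply: (@no_four_corners _ A nestA x h 1 (b * a^-1) a b (A x) (A h));
      rewrite ?mulg1 //.
    - by rewrite mulgA (E _ _ _ xba') (E _ _ _ xb); case: (A x).
    - by rewrite mulgA (E _ _ _ (negbTE nhba')) (E _ _ _ hb); case: (A h).
    - by rewrite (E _ _ _ xa) addbT.
    - by rewrite (E _ _ _ (negbTE nha)) addbF.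
    - by rewrite (E _ _ _ xb) addbT.
    - by rewrite (E _ _ _ hb) addbT.
  have fU : finite_set (C1 `|` [set x | C2 (x * b)]) by rewrite finite_setU.
  have := ncard_sub fU cover; have := ncardUI fC1 fC2b; rewrite cC2b.
  have : 0 < ncard (C1 `&` [set x | C2 (x * b)]).
    rewrite lt0n; apply/eqP => /ncard_eq0-/(_ (finite_setIl _ fC1)) e.
    have : set0 x by rewrite -e; split;
      [rewrite /C1 /= xa | rewrite /C2 /= xba'].
    by [].
  have := C1_small; have := C2_small; have := big; rewrite /norm.
  move: (ncard C1) (ncard C2) (ncard (walls A b)) (ncard (_ `|` _))
    (ncard (_ `&` _)); lia.
have min' : lex_minimal A (a * b^-1) b.
  case: minA => cA gen m; split=> //.
  by have -> : norm A (a * b^-1) = norm A a by have := norm_ab'; lia.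
have C1a x : C1 x -> parts A b^-1 (x * a).
  move=> xC; have /andP[xa xb] := xC.
  have := lex_minimal_avoid min' xb; rewrite invgM invgK !partsM xa xb /=.
  have -> /= : ~~ parts A a^-1 (x * b).
    by apply/negP => xba'; apply: (disj x xC); rewrite /C2 /= xba' partsV.
  by case: (parts A b^-1 (x * a)) => // /(_ isT).
have C1aC2 : (fun x => x * a) @` C1 `<=` C2.
  by move=> _ [x xC <-]; rewrite /C2 /= partsV C1a// andbT; case/andP: xC.
have C2C1a h : C2 (h * a) -> C1 h.
  move=> hC; apply: contrapT => nh.
  have nhC : ~ ((fun x => x * a) @` C1) (h * a).
    by case=> x xC /mulIg xh; apply: nh; rewrite -xh.
  by have := ncard_lt fC2 C1aC2 hC nhC; rewrite ncard_mulr// c12 ltnn.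
have [x /andP[xa xb]] := ab.
have SaC1 : walls A a `<=` C1.
  move=> h ha; rewrite /walls /= in ha; rewrite /C1 /= ha /=.
  apply/negPn/negP => nhb.
  have nhab' : ~~ parts A b^-1 (h * a).
    apply: contra nhb => hab'.
    by have /andP[] : C1 h by apply: C2C1a; rewrite /C2 /= partsV ha.
  apply: (@no_four_corners _ A nestA x h 1 (a * b^-1) b a (A x) (A h));
    rewrite ?mulg1 //.
  - rewrite mulgA (E _ _ _ (C1a x _)) ?(E _ _ _ xa); first by case: (A x).
    by rewrite /C1 /= xa.
  - by rewrite mulgA (E _ _ _ (negbTE nhab')) (E _ _ _ ha); case: (A h).
  - by rewrite (E _ _ _ xb) addbT.
  - by rewrite (E _ _ _ (negbTE nhb)) addbF.
  - by rewrite (E _ _ _ xa) addbT.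
  - by rewrite (E _ _ _ ha) addbT.
have := ncard_sub fC1 SaC1; have := C1_small; have := le_ba; have := b_gt0.
rewrite /norm; lia.
Qed.

(** By [overlap_small], [b] has a wall outside both [C1] and the final segment
    given by [C2], and so has [a], which is not shorter than [b]. These walls
    are crossed by no other letter. *)
Lemma pingpong_overlap : pingpong a b.
Proof.
have [fC2b cC2b] := C2_pull b.
have [fC2a cC2a] := C2_pull a.
have [hb [hbb nhba nhba']] : exists h,
  [/\ parts A b h, ~~ parts A a h & ~~ parts A a^-1 (h * b)].
  apply: contrapT => /forallNP H.
  have cover : walls A b `<=` C1 `|` [set x | C2 (x * b)].
    move=> h hb; rewrite /walls /= in hb.
    have [ha|nha] := boolP (parts A a h); first by left; rewrite /C1 /= ha.
    right; rewrite /C2 /= partsV hb andbT; apply/negPn/negP => nhba'.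
    exact: (H h).
  by have := ncard_cover fC1 fC2b cover; have := overlap_small;
    rewrite cC2b /norm; lia.
have [ha [haa nhab nhab']] : exists h,
  [/\ parts A a h, ~~ parts A b h & ~~ parts A b^-1 (h * a)].
  apply: contrapT => /forallNP H.
  have cover : walls A a `<=` C1 `|` [set x | C2 (x * a)].
    move=> h ha; rewrite /walls /= in ha.
    have [hb'|nhb] := boolP (parts A b h); first by left; rewrite /C1 /= ha.
    right; rewrite /C2 /= partsV ha /=; apply/negPn/negP => nhab'.
    exact: (H h).
  have := ncard_cover fC1 fC2a cover; have := overlap_small; have := le_ba.
  by rewrite cC2a /norm; lia.
pose gen d := if d then a else b; pose wit d := if d then ha else hb.
pose y l := if l.2 then gen l.1 else (gen l.1)^-1 : G.
pose h l := if l.2 then wit l.1 else wit l.1 * gen l.1.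
apply: (@pingpong_schottky G A nestA y h).
- by move=> d [] //=; rewrite invgK.
- by move=> d [] //=; rewrite mulgK.
have ha'a' : parts A a^-1 (ha * a) by rewrite partsV.
have hb'b' : parts A b^-1 (hb * b) by rewrite partsV.
case=> [[] []] [[] []]; rewrite /y /h /= ?haa ?hbb ?ha'a' ?hb'b' //;
  apply/negbTE => //.
- by apply/negP => /aa'; rewrite ha'a'.
- by apply/negP => /ab'; rewrite hb'b'.
- exact: aa'.
- by apply/negP => /a'b; rewrite hbb.
- exact: a'b.
- by apply/negP => /bb'; rewrite hb'b'.
- exact: ab'.
- exact: bb'.
Qed.
End Overlap.

Theorem pingpong_of_minimal (G : groupType) (A : G -> bool) (a b : G) :
  torsion_free G -> nested A -> lex_minimal A a b -> b <> 1 ->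
  exists a' b' : G, generates [set a'; b'] /\ pingpong a' b'.
Proof.
move=> tfG nestA minA b1.
have [cA gen m] := minA; have [fA iA iA'] := cA.
have [b0|b_gt0] := posnP (norm A b).
  have nb x : ~~ parts A b x.
    apply/negP => xb; have : set0 x by rewrite -(ncard_eq0 (fA b) b0).
    by [].
  have aa : codir A a a.
    apply: contrapT => /forallNP na.
    have na' x : ~~ parts A a x by apply/negP => xa; apply: (na x); rewrite xa.
    have [[x Ax] [y Ay]] := (infinite_setN0 iA, infinite_setN0 iA').
    by move: Ay; rewrite /= -(generates_const gen na' nb x) Ax.
  have [a' [gen' pp]] := pingpong_elliptic nestA tfG fA b1 nb aa gen.
  by exists a', b.
have rr u : (0 < norm A u)%N -> codir A u u.
  move=> u0; apply: contrapT => /forallNP nu; move: u0; rewrite lt0n => /eqP;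
    apply.
  rewrite /norm (_ : walls A u = set0) ?/ncard ?fset_set0//.
  by apply/seteqP; split=> x // xu; apply: (nu x); rewrite andbb.
have a_gt0 : (0 < norm A a)%N.
  apply: leq_trans b_gt0 _; have [] // := m A b a cA.
  by apply: (generates_pair gen) => H _ _ Ha Hb.
have [aa bb] := (rr a a_gt0, rr b b_gt0).
have V : norm A b^-1 = norm A b by rewrite normV.
have [ab|n1] := pselect (codir A a b).
  by exists a, b; split=> //; exact: pingpong_overlap nestA minA ab b_gt0.
have [ab|n2] := pselect (codir A a b^-1).
  have minV := lex_minimalVr minA; have [_ genV _] := minV.
  by exists a, b^-1; split=> //; apply: (pingpong_overlap nestA minV ab);
    rewrite ?V.
have minV := lex_minimalVl minA; have [_ genV _] := minV.
have [ab|n3] := pselect (codir A a^-1 b).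
  by exists a^-1, b; split=> //; apply: (pingpong_overlap nestA minV ab);
    rewrite ?V.
have [ab|n4] := pselect (codir A a^-1 b^-1).
  have minV' := lex_minimalVr minV; have [_ genV' _] := minV'.
  by exists a^-1, b^-1; split=> //; apply: (pingpong_overlap nestA minV' ab);
    rewrite ?V.
by exists a, b; split=> //; apply: pingpong_transverse.
Qed.

(** * Reduced words and bases *)

Section Words.
Variable T : eqType.
Implicit Types (l : T * bool) (w : seq (T * bool)).

Definition inv_letter l : T * bool := (l.1, ~~ l.2).
Definition inv_word w := rev [seq inv_letter l | l <- w].
Definition reduced w := sorted (fun l l' => l' != inv_letter l) w.

Definition eval_letter (G : groupType) (f : T -> G) l : G :=
  if l.2 then f l.1 else (f l.1)^-1.
Definition eval (G : groupType) (f : T -> G) w : G :=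
  foldr (fun l g => eval_letter f l * g) 1 w.

Lemma eval_cat (G : groupType) (f : T -> G) w1 w2 :
  eval f (w1 ++ w2) = eval f w1 * eval f w2.
Proof. by elim: w1 => [|l w IH] /=; rewrite ?mul1g// IH mulgA. Qed.

Lemma eval_inv_letter (G : groupType) (f : T -> G) l :
  eval_letter f (inv_letter l) = (eval_letter f l)^-1.
Proof. by case: l => t []; rewrite /eval_letter /= ?invgK. Qed.

Lemma eval_inv_word (G : groupType) (f : T -> G) w :
  eval f (inv_word w) = (eval f w)^-1.
Proof.
elim: w => [|l w IH]; first by rewrite invg1.
by rewrite /inv_word /= rev_cons -cats1 eval_cat -/(inv_word w) IH /= mulg1
  eval_inv_letter invgM.
Qed.

Lemma not_reduced w : ~~ reduced w ->
  exists w1 l w2, w = w1 ++ l :: inv_letter l :: w2.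
Proof.
elim: w => // l [|l' w] IH //=; rewrite /reduced /= negb_and negbK =>
  /orP[/eqP ->|/IH].
  by exists [::], l, w.
by case=> w1 [m [w2 ->]]; exists (l :: w1), m, w2.
Qed.

Section Free.
Variables (G : groupType) (gen : T -> G).
Hypothesis gen_surj : forall g, exists w, eval gen w = g.
Hypothesis gen_free : forall w, reduced w -> w <> [::] -> eval gen w <> 1.

(** A word that is trivial in [G] can be cancelled down to the empty word, and
    each cancellation preserves the value in [H] as well. *)
Lemma eval_trivial (H : groupType) (f : T -> H) w : eval gen w = 1 ->
  eval f w = 1.
Proof.
have [n] := ubnP (size w); elim: n w => // n IH w wn w1.
have [->//|/eqP w0] := eqVneq w [::].
have [red|/not_reduced[u [l [v wE]]]] := boolP (reduced w).
  by case: (gen_free red w0).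
have E (K : groupType) (h : T -> K) : eval h w = eval h (u ++ v).
  by rewrite wE !eval_cat /= eval_inv_letter mulVKg.
rewrite E; apply: IH; last by rewrite -E.
rewrite -ltnS; apply: leq_trans wn.
by rewrite wE !size_cat /= !addnS.
Qed.

Lemma eval_eq (H : groupType) (f : T -> H) w1 w2 :
  eval gen w1 = eval gen w2 -> eval f w1 = eval f w2.
Proof.
move=> e; apply: divg1_eq; rewrite -eval_inv_word -eval_cat.
by apply: eval_trivial; rewrite eval_cat eval_inv_word e mulgV.
Qed.

(** By [eval_eq] the value in [H] of a word depends only on its value in [G]. *)
Lemma basis_of_reduced : is_basis (range gen).
Proof.
move=> H f.
have [rep repE] := choice gen_surj.
pose h := f \o gen.
have phiE w : eval h (rep (eval gen w)) = eval h w by apply: eval_eq;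
  rewrite repE.
exists (fun g => eval h (rep g)); split.
  split.
    split; first by have := phiE [::].
    by move=> x y; rewrite -eval_cat; apply: eval_eq; rewrite eval_cat !repE.
  move=> _ [t _ <-]; have := phiE [:: (t, true)].
  by rewrite /= /eval_letter /= !mulg1.
move=> phi [[phi1 phiM] phif]; apply: funext => g.
have phiV x : phi x^-1 = (phi x)^-1.
  by apply/esym/mulg1_eq; rewrite -phiM mulgV phi1.
rewrite -{2}(repE g); elim: (rep g) => [|l w IH] /=; first by rewrite phi1.
rewrite phiM -IH; congr (_ * _).
by rewrite /eval_letter /h; case: (l.2); rewrite ?phiV /= phif //; exists l.1.
Qed.
End Free.

Lemma words_generate (G : groupType) (f : T -> G) (S : set G) : generates S ->
  (forall s, S s -> exists w, eval f w = s) ->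
  forall g, exists w, eval f w = g.
Proof.
move=> genS wordS; apply: (generates_ind genS) => //.
- by exists [::].
- by move=> _ _ [u <-] [v <-]; exists (u ++ v); rewrite eval_cat.
- by move=> _ [u <-]; exists (inv_word u); rewrite eval_inv_word.
Qed.
End Words.

Lemma free_trivial (G : groupType) : (forall g : G, g = 1) -> free_group G.
Proof.
move=> triv; exists (range (fun t : void => match t return G with end)).
apply: basis_of_reduced => [g|[|[[]]]//].
by exists [::]; rewrite [g]triv.
Qed.

Lemma free_cyclic (G : groupType) (a : G) : torsion_free G -> a <> 1 ->
  generates [set a; 1] -> free_group G.
Proof.
move=> tfG a1 gen; exists (range (fun _ : unit => a)).
apply: basis_of_reduced.
  apply: (words_generate gen) => _ [->|->]; last by exists [::].
  by exists [:: (tt, true)]; rewrite /= /eval_letter mulg1.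
case=> // l w red _.
have -> : eval (fun=> a) (l :: w) = eval_letter (fun=> a) l ^+ (size w).+1.
  elim: w l red => [|l' w IH] l /=; first by rewrite mulg1.
  move=> /andP[l'l red]; have el : l' = l.
    by move: l'l; case: l {red} l' => [[] s] [[] s']; case: s s' => [] [].
  by rewrite el in red *; rewrite expgS -(IH l).
move=> /tfG-/(_ isT); case: l {red} => t []; rewrite /eval_letter //=.
by move=> e; apply: a1; rewrite -[a]invgK e invg1.
Qed.

Section PingpongFree.
Variables (G : groupType) (a b : G) (U : set G).
Hypothesis UP : forall k g,
    (~ U g -> U (a ^+ k.+1 * g) /\ U (a^-1 ^+ k.+1 * g)) /\
    (U g -> ~ U (b ^+ k.+1 * g) /\ ~ U (b^-1 ^+ k.+1 * g)).

Let gen (d : bool) := if d then a else b.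
Let V (d : bool) g := if d then U g else ~ U g.

Let VN d g : ~ V d g <-> V (~~ d) g.
Proof. by case: d => //=; rewrite notK. Qed.

Let V_letter l k g : ~ V l.1 g -> V l.1 (eval_letter gen l ^+ k.+1 * g).
Proof.
have [Ua Ub] := UP k g.
by case: l => [] [] [] /=; rewrite /eval_letter /=;
  [case/Ua|case/Ua|case/contrapT/Ub|case/contrapT/Ub].
Qed.

(** The factor [eval_letter gen l ^+ k] collects the repetitions of [l] read so
    far, because ping-pong moves a point to the other table only by a whole
    maximal power. *)
Let V_word w l k p : reduced (l :: w) -> ~ V (last l w).1 p ->
  V l.1 (eval_letter gen l ^+ k * eval gen (l :: w) * p).
Proof.
elim: w l k => [|l' w IH] l k.
  by move=> _ np; rewrite /= mulg1 -expgSr; exact: V_letter.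
move=> /= /andP[l'l red] np.
have [e|ne] := eqVneq l'.1 l.1.
  have el : l' = l.
    by move: l'l e; rewrite /inv_letter; case: l l' {red np} =>
      d s [d' s'] /= + e;
      rewrite e xpair_eqE eqxx /=; case: s s' => [] [].
  rewrite el in red np *; rewrite mulgA -expgSr; exact: IH.
rewrite mulgA -expgSr -mulgA; apply: V_letter; apply/VN.
have -> : ~~ l.1 = l'.1 by case: (l'.1) (l.1) ne => [] [].
by have := IH l' 0 red np; rewrite mul1g.
Qed.

Let V_ex d : exists p, V d p.
Proof.
have [[Ua _] [_ Ub]] := (UP 0 1, UP 0 1).
have [U1|nU1] := pselect (U 1); case: d;
  by [exists 1 | exists (b ^+ 1 * 1); case: (Ub U1) | exists (a ^+ 1 * 1); case:
  (Ua nU1)].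
Qed.

Lemma pingpong_reduced w : reduced w -> w <> [::] -> eval gen w <> 1.
Proof.
have main l w' : reduced (l :: w') -> (last l w').1 = l.1 ->
  eval gen (l :: w') <> 1.
  move=> red e ev; have [p /VN np] := V_ex (~~ l.1).
  have np' : ~ V (last l w').1 p by rewrite e.
  by apply: np; have := V_word 0 red np'; rewrite mul1g ev mul1g.
case: w => // l w' red _ ev.
have [e|ne] := eqVneq (last l w').1 l.1; first exact: main ev.
(* Conjugating by the first letter makes the word begin and end with letters of
   the same generator, and keeps it reduced. *)
apply: (main l (rcons (l :: w') (inv_letter l))).
- rewrite /reduced /= rcons_path; apply/and3P; split=> //.
    by case: l {red ev ne} => t []; rewrite /inv_letter xpair_eqE eqxx.
  by apply: contra ne => /eqP[->].
- by rewrite last_rcons.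
- by rewrite -cats1 -cat_cons -(cat1s l) !eval_cat ev /= !mulg1 eval_inv_letter
  mulgV.
Qed.
End PingpongFree.

Lemma free_of_pingpong (G : groupType) (a b : G) :
  generates [set a; b] -> pingpong a b -> free_group G.
Proof.
move=> gen [U UP]; exists (range (fun d : bool => if d then a else b)).
apply: basis_of_reduced; last exact: pingpong_reduced UP.
apply: (words_generate gen) => _ [->|->].
  by exists [:: (true, true)]; rewrite /= /eval_letter mulg1.
by exists [:: (false, true)]; rewrite /= /eval_letter mulg1.
Qed.

(** * Ends and cuts *)

Section Ends.
Variables (G : groupType) (S : {fset G}).
Hypothesis genS : generates [set` S].
Hypothesis infG : infinite_set [set: G].
Hypothesis no_cut : forall A : G -> bool, ~ cut A.

Let e := cayley S.

Lemma joined_refl (K : {fset G}) x : x \notin K -> joined_outside e K x x.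
Proof. by move=> xK; exists [::]; rewrite /= xK. Qed.

Lemma joined_trans (K : {fset G}) x y z :
  joined_outside e K x y -> joined_outside e K y z -> joined_outside e K x z.
Proof.
case=> p [ep <- /= /andP[xK pK]] [q [eq <- /= /andP[_ qK]]].
by exists (p ++ q); rewrite cat_path ep eq last_cat /= xK all_cat pK qK.
Qed.

Lemma joined_edge (K : {fset G}) x y : x \notin K -> y \notin K -> e x y ->
  joined_outside e K x y.
Proof. by move=> xK yK exy; exists [:: y]; rewrite /= exy xK yK. Qed.

Lemma cayley_sym x y : e x y = e y x.
Proof. by rewrite /e /cayley /= orbC. Qed.

Lemma joined_sym (K : {fset G}) x y : joined_outside e K x y ->
  joined_outside e K y x.
Proof.
case=> p; elim: p x => [|z p IH] x [/= exp yE xpK].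
  by rewrite -yE; apply: joined_refl; case/andP: xpK.
case/andP: exp => exz ezp; case/and3P: xpK => xK zK pK.
apply: (joined_trans (IH z _)); first by split=> //=; rewrite zK.
by apply: joined_edge; rewrite // cayley_sym.
Qed.

Lemma joined_sub (K L : {fset G}) x y : {subset K <= L} ->
  joined_outside e L x y -> joined_outside e K x y.
Proof.
move=> KL [p [ep yE pL]]; exists p; split=> //.
by apply: sub_all pL => z; apply: contra; exact: KL.
Qed.

Lemma joined_notin (K : {fset G}) x y : joined_outside e K x y -> y \notin K.
Proof. by case=> p [_ <- /allP]; apply; exact: mem_last. Qed.

Definition component (K : {fset G}) (x y : G) : bool :=
  `[< joined_outside e K x y >].

Lemma component_edge (K : {fset G}) x y s : s \in S -> y \notin K ->
  y * s \notin K ->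
  component K x (y * s) = component K x y.
Proof.
move=> sS yK ysK; have eys : e y (y * s) by rewrite /e /cayley /= mulKg sS.
apply: asbool_equiv_eq; split=> xy; apply: (joined_trans xy).
  by apply/joined_sym/joined_edge.
exact: joined_edge.
Qed.

(** A generator can leave or enter a component only through [K]. *)
Lemma component_almost_invariant (K : {fset G}) x u :
  finite_set (walls (component K x) u).
Proof.
apply: (generates_finite_walls genS) => s sS.
apply: (@sub_finite_set _ _ ([set` K] `|` (fun k => k * s^-1) @` [set` K])).
  move=> y; rewrite /walls /= /parts => ys.
  have [yK|yK] := boolP (y \in K); first by left.
  have [ysK|ysK] := boolP (y * s \in K); first by right; exists (y * s);
    rewrite ?mulgK.
  by move: ys; rewrite component_edge// addbb.
by rewrite finite_setU; split; [|apply: finite_image]; exact: finite_fset.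
Qed.

Lemma component_finite_or_cofinite (K : {fset G}) x :
  finite_set [set y | component K x y] \/ finite_set
    [set y | ~~ component K x y].
Proof.
apply: contrapT => /not_orP[i1 i2]; apply: (no_cut (A := component K x));
  split=> // u.
exact: component_almost_invariant.
Qed.

(** A component with no vertex next to [K] is stable under all generators,
    hence is the whole of [G]. So if all components were finite, those of the
    finitely many neighbours of [K] would cover [G] up to [K]. *)
Lemma cofinite_component (K : {fset G}) :
  exists x, x \notin K /\ finite_set [set y | ~~ component K x y].
Proof.
apply: contrapT => /forallNP none.
have fin x : x \notin K -> finite_set [set y | component K x y].
  move=> xK; have [//|cof] := component_finite_or_cofinite K x.
  by case: (none x).
pose K' := ((fun p : G * G => p.1 * p.2) @` ([set` K] `*` [set` S])) `|`
           ((fun p : G * G => p.1 * p.2^-1) @` ([set` K] `*` [set` S])).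
have finK' : finite_set K'.
  by rewrite finite_setU; split; apply/finite_image/finite_setX; exact:
    finite_fset.
have near x : x \notin K -> exists y, K' y /\ component K x y.
  move=> xK; apply: contrapT => /forallNP far.
  have inv u : forall y, component K x (y * u) = component K x y.
    apply: (generates_ind (P := fun u => forall y,
      component K x (y * u) = component K x y) genS).
    - by move=> y; rewrite mulg1.
    - by move=> v v' ev ew y; rewrite mulgA ew ev.
    - by move=> v ev y; rewrite -[in RHS](mulgVK v y) ev.
    move=> s sS y; rewrite /= in sS.
    have [yK|yK] := boolP (y \in K).
      have -> : component K x y = false by apply/asboolPn => /joined_notin;
        rewrite yK.
      by apply/negP => ys; apply: (far (y * s)); split=> //; left;
        exists (y, s).
    have [ysK|ysK] := boolP (y * s \in K); last exact: component_edge.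
    have -> : component K x (y * s) = false by apply/asboolPn => /joined_notin;
      rewrite ysK.
    apply/esym/negP => ys; apply: (far y); split=> //; right.
    by exists (y * s, s) => //=; rewrite mulgK.
  apply: infG; apply: sub_finite_set (fin x xK) => y _ /=.
  rewrite -(mulVKg x y) inv; apply/asboolP; exact: joined_refl.
apply: infG; apply: (@sub_finite_set _ _ ([set` K] `|`
    \bigcup_(y in K' `&` [set y | y \notin K]) [set z | component K y z])).
  move=> x _; have [xK|xK] := boolP (x \in K); first by left.
  have [y [K'y /asboolP xy]] := near x xK.
  by right; exists y;
    [split=> //; exact: joined_notin xy | apply/asboolP/joined_sym].
rewrite finite_setU; split; first exact: finite_fset.
apply: bigcup_finite; first exact: finite_setIl.
by move=> y [_ yK]; exact: fin.
Qed.

Lemma cofinite_component_meets (K : {fset G}) x (X : set G) :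
  finite_set [set y | ~~ component K x y] -> infinite_set X -> exists z,
    component K x z /\ X z.
Proof.
move=> cof infX; have [z [Xz /= /negP]] :=
  infinite_setN0 (infinite_setD infX cof).
by rewrite negbK; exists z.
Qed.

(** The cofinite components form an end, as any two cofinite sets meet. An end
    cannot choose a finite component [F] outside [K], because its choice
    outside the union of [K] and [F] would have to lie in [F]. *)
Lemma one_ended_cayley : one_ended_graph (cayley S).
Proof.
have [base baseP] := choice cofinite_component.
have cofI K : infinite_set [set y | component K (base K) y].
  move=> fin; apply: infG; have [_ cof] := baseP K.
  apply: (@sub_finite_set _ _
    ([set y | component K (base K) y] `|` [set y | ~~ component K (base K) y])).
    by move=> y _ /=; case: (component K _ y); [left | right].
  by rewrite finite_setU.
exists (fun K => [set y | joined_outside e K (base K) y]); split.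
  split=> [K|K L KL y yL]; first by exists (base K); first exact: (baseP K).1.
  have [z [/asboolP zK /asboolP zL]] :=
    cofinite_component_meets (baseP K).2 (cofI L).
  apply: (joined_trans zK); apply: (joined_sub (L := L)); first
    by apply/fsubsetP.
  by apply: joined_trans yL; exact: joined_sym.
move=> eps [componentE monoE]; apply: funext => K.
have [x xK epsK] := componentE K.
have inf_eps : infinite_set (eps K).
  move=> fin; pose L := (K `|` fset_set (eps K))%fset.
  have [y yL epsL] := componentE L.
  have KL : (K `<=` L)%fset by exact: fsubsetUl.
  have yy : eps L y by rewrite epsL; exact: joined_refl.
  by move: yL; rewrite in_fsetU negb_or in_fset_set// => /andP[_ /negP]; apply;
    rewrite inE; exact: monoE yy.
have [z [/asboolP zK]] := cofinite_component_meets (baseP K).2 inf_eps.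
rewrite epsK => /= xz; apply/seteqP; split=> y /= ky.
  by apply: (joined_trans xz); apply: joined_trans ky; exact: joined_sym.
by apply: (joined_trans zK); apply: joined_trans ky; exact: joined_sym.
Qed.
End Ends.

(** * Groups with a cut *)

(** The least pair [(beta, alpha)] of values of [norm A b] and [norm A a] is
    attained by cuts of least cost for the weight [w = alpha], and one of these
    can be taken nested. *)
Lemma exists_lex_minimal (G : groupType) (a0 b0 : G) (A0 : G -> bool) :
  generates [set a0; b0] -> cut A0 ->
  exists (A : G -> bool) (a b : G), lex_minimal A a b /\ nested A.
Proof.
move=> gen0 cut0.
pose P n := `[< exists (A : G -> bool) (a b : G),
  [/\ cut A, generates [set a; b] & norm A b = n] >].
have exP : exists n, P n by exists (norm A0 b0); apply/asboolP; exists A0, a0,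
  b0.
case: (ex_minnP exP) => beta /asboolP[A1 [a1 [b1 [cut1 gen1 norm1]]]] betaP.
have {}betaP (A : G -> bool) (a b : G) : cut A -> generates [set a; b] ->
  (beta <= norm A b)%N.
  by move=> cA gen; apply: betaP; apply/asboolP; exists A, a, b.
pose Q n := `[< exists (A : G -> bool) (a b : G),
  [/\ cut A, generates [set a; b], norm A b = beta & norm A a = n] >].
have exQ : exists n, Q n by exists (norm A1 a1); apply/asboolP; exists A1, a1,
  b1.
case: (ex_minnP exQ) =>
  alpha /asboolP[A2 [a [b [cut2 gen norm2b norm2a]]]] alphaP.
have {}alphaP (A : G -> bool) (a' b' : G) : cut A -> generates [set a'; b'] ->
    norm A b' = beta -> (alpha <= norm A a')%N.
  by move=> cA gen' nb; apply: alphaP; apply/asboolP; exists A, a', b'.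
have cost_min A : cut A -> (alpha.+1 * beta + alpha <= cost a b alpha A)%N.
  move=> cA; rewrite /cost; have le1 := betaP A a b cA gen.
  have [e|ne] := eqVneq (norm A b) beta.
    by have := alphaP A a b cA gen e; rewrite e leq_add2l.
  (* An excess of 1 in norm A b costs alpha + 1, more than a shorter a saves. *)
  have lt1 : (beta.+1 <= norm A b)%N by rewrite ltn_neqAle eq_sym ne.
  by have := leq_mul (leqnn alpha.+1) lt1; lia.
have nar2 : narrow a b alpha (alpha.+1 * beta + alpha) A2.
  by split=> //; rewrite /cost norm2a norm2b.
have [A [[cA costA] nestA]] := nested_narrow gen cost_min (ex_intro _ A2 nar2).
have nb : norm A b = beta.
  apply/eqP; rewrite eqn_leq (betaP A a b cA gen) andbT leqNgt; apply/negP =>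
    lt1.
  by have := leq_mul (leqnn alpha.+1) lt1; move: costA; rewrite /cost; lia.
have na : norm A a = alpha by move: costA; rewrite /cost nb; lia.
exists A, a, b; split=> //; split=> // A' a' b' cA' gen'.
by rewrite nb na; split; [exact: (betaP A' a' b') | exact: alphaP].
Qed.

(** The minimal pair may have [b] trivial; ping-pong is not available then, but
    [a] alone generates [G]. *)
Lemma free_of_cut (G : groupType) (a b : G) (A : G -> bool) : torsion_free G ->
  generates [set a; b] -> cut A -> free_group G.
Proof.
move=> tfG gen0 cutA.
have [{cutA}A [{gen0}a [{}b [minA nestA]]]] := exists_lex_minimal gen0 cutA.
have [cA gen _] := minA.
have [b1|b1] := pselect (b = 1); last first.
  by have [a' [b' [gen' pp]]] := pingpong_of_minimal tfG nestA minA b1; exact: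
    free_of_pingpong pp.
have [a1|a1] := pselect (a = 1); last first.
  by apply: (@free_cyclic G a) => //; rewrite -b1.
apply: free_trivial; apply: (generates_ind (P := fun g => g = 1) gen) => //.
- by move=> u v -> ->; rewrite mulg1.
- by move=> u ->; rewrite invg1.
- by move=> s [->|->].
Qed.

Theorem proposition7 (G : groupType) (tfG : torsion_free G)
    (genG : two_generated G) (nfreeG : ~ free_group G) : one_ended G.
Proof.
have [a [b gen]] := genG.
have no_cut (A : G -> bool) : ~ cut A by move=> cutA;
  apply/nfreeG/(free_of_cut tfG gen cutA).
have infG : infinite_set [set: G].
  move=> finG; apply/nfreeG/free_trivial => g; apply: contrapT => g1.
  exact: (pow_escape tfG g1 finG).
split=> [|S genS]; last exact: one_ended_cayley.
exists [fset a; b]%fset; rewrite (_ : [set` _] = [set a; b])//.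
apply/seteqP; split=> x; rewrite /= !inE; first by case/orP=> /eqP;
  [left|right].
by case=> ->; rewrite eqxx ?orbT.
Qed.
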